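(* Let $0\le\alpha<2$, $\sigma\ge0$ and $$\mu(s)=\kappa_1s^{-\omega_1}e^{-\delta_1s},\qquad 0\le\omega_1<\frac{2-\alpha}{2},\quad \kappa_1,\delta_1>0,\qquad \beta(s)=0.$$ Then the semigroup $S_{\alpha,\sigma}(t)$ is not exponentially stable on $\mathcal H$.
   Context: $\mathbb R^+=(0,\infty)$; $\Omega\subset\mathbb R^2$ is a smooth bounded domain. $A$ is a strictly positive selfadjoint linear operator on $L^2(\Omega)$ with domain $\mathcal D(A)$, whose spectrum consists of a diverging sequence of positive eigenvalues $\{\gamma_n\}_{n\ge1}$ (discrete spectrum, as for $-\Delta$ with Dirichlet conditions). For $r\in\mathbb R$, $H^r=\mathcal D(A^{r/2})$ with $\langle u_1,u_2\rangle_{H^r}=\langle A^{r/2}u_1,A^{r/2}u_2\rangle_{L^2(\Omega)}$. Spaces: for kernels $\mu,\beta\ge0$ on $\mathbb R^+$, $\mathcal M_\alpha=L^2_\mu(\mathbb R^+,H^\alpha)$, $\mathcal Q=L^2_\beta(\mathbb R^+,H^2)$ (weighted $L^2$ spaces, e.g. $\|\eta\|^2_{\mathcal M_\alpha}=\int_0^\infty\mu(s)\|\eta(s)\|^2_{H^\alpha}ds$), and $\mathcal H=H^2\times H^0\times H^0\times\mathcal M_\alpha\times\mathcal Q$ with $\|(u,v,\vartheta,\eta,\xi)\|^2_{\mathcal H}=\|u\|^2_{H^2}+\|v\|^2_{H^0}+\|\vartheta\|^2_{H^0}+\|\eta\|^2_{\mathcal M_\alpha}+\|\xi\|^2_{\mathcal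 Q}$. When $\beta=0$, $\mathcal Q$ is the zero space, so the $\xi$ component and its equation are absent. Semigroup: $T\eta=-\eta_s$ on $\mathcal D(T)=\{\eta\in\mathcal M_\alpha:\eta_s\in\mathcal M_\alpha,\eta(0)=0\}$ and $T'\xi=-\xi_s$ on $\mathcal D(T')=\{\xi\in\mathcal Q:\xi_s\in\mathcal Q,\xi(0)=0\}$ (distributional derivative in $s$). $S_{\alpha,\sigma}(t)$ is the $C_0$-semigroup of contractions on $\mathcal H$ mapping $z_0=(u_0,u_1,\vartheta_0,\eta_0,\xi_0)$ to the value $(u(t),u_t(t),\vartheta(t),\eta^t,\xi^t)$ of the (mild) solution in $C([0,\infty),\mathcal H)$ of $$\begin{cases}u_{tt}+\int_0^\infty\beta(s)A^2\xi(s)ds+A^2u-A^\sigma\vartheta=0,\\ \vartheta_t+\int_0^\infty\mu(s)A^\alpha\eta(s)ds+A^\sigma u_t=0,\\ \eta_t=T\eta+\vartheta,\\ \xi_t=T'\xi+u_t\end{cases}$$ with initial value $z_0$. Its generator is (the closure of) the operator $\mathcal L$ given by writing the system as $\zeta_t=\mathcal L\zeta$, $\zeta=(u,v,\vartheta,\eta,\xi)$, $v=u_t$, on the domain of those $z\in\mathcal H$ such that $Au\in H^2$, $v\in H^{2\sigma}$, $\vartheta\in H^{2\sigma}$, $\int_0^\infty\mu A^\alpha\eta\,ds\in H^0$, $\int_0^\infty\beta A^2\xi\,ds\in H^0$, $\eta\in\mathcal D(T)$, $\xi\in\mathcal D(T')$ and $\mathcal Lz\in\mathcal H$. $S_{\alpha,\sigma}(t)$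 is exponentially stable on $\mathcal H$ if there are $M\ge1$, $\omega>0$ with $\|S_{\alpha,\sigma}(t)z\|_{\mathcal H}\le Me^{-\omega t}\|z\|_{\mathcal H}$ for all $t\ge0$, $z\in\mathcal H$. *)

(* Defs.v *)
From HB Require Import structures.
From mathcomp Require Import all_boot all_order all_algebra.
From mathcomp Require Import all_classical all_reals all_analysis.

Set Implicit Arguments.
Unset Strict Implicit.
Unset Printing Implicit Defensive.

Import Order.TTheory GRing.Theory Num.Theory.
Import numFieldNormedType.Exports.

Local Open Scope classical_set_scope.
Local Open Scope ring_scope.

(* L^2(Omega) and the weighted spaces built on it are handled through
   representatives (functions, not classes of functions): two elements are
   identified when the norm of their difference vanishes, so every equality
   between vectors below is an equality up to [nrm (x - y) = 0]. *)

Section SmoothDomain.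
Context {R : realType}.

Definition smooth (f : R -> R) := forall n x, derivable (derive1n n f) x 1.

(* Near each boundary point, after possibly exchanging ([sw]) and reflecting
   ([sg]) the axes, Omega is the set of points above the graph of a smooth
   function. *)
Definition smooth_boundary (Omega : set (R * R)) :=
  forall p, closure Omega p -> ~ Omega p ->
  exists (h : R -> R) (sw sg : bool), smooth h /\
    \forall q \near p,
      let: (x, y) := if sw then (q.2, q.1) else q in
      Omega q <-> 0 < (-1) ^+ sg * (y - h x).

Record smooth_bounded_domain := SmoothBoundedDomain {
  domain_set :> set (R * R) ;
  domain_open : open domain_set ;
  domain_connected : connected domain_set ;
  domain_nonempty : domain_set !=set0 ;
  domain_bounded : bounded_set domain_set ;
  domain_smooth : smooth_boundary domain_set }.

Notation plane := (measurableTypeR R * measurableTypeR R)%type.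

Lemma open_measurable_plane (O : set (R * R)) :
  open O -> measurable (O : set plane).
Proof.
move=> oO.
pose box (q : (rat * rat) * (rat * rat)) : set plane :=
  `]ratr q.1.1, ratr q.1.2[%classic `*` `]ratr q.2.1, ratr q.2.2[%classic.
have -> : (O : set plane) = \bigcup_(q in [set q | box q `<=` O]) box q.
  apply/seteqP; split => [[x y] Oxy|z [q /= qO zq]]; last exact: qO.
  have /nbhs_ballP[e /= e0 eO] : nbhs ((x, y) : R * R) O by exact: open_nbhs_nbhs.
  have xm : x - e < x by rewrite ltrBlDr ltrDl.
  have xp : x < x + e by rewrite ltrDl.
  have ym : y - e < y by rewrite ltrBlDr ltrDl.
  have yp : y < y + e by rewrite ltrDl.
  have [a1 /itvP a1x] := rat_in_itvoo xm.
  have [b1 /itvP b1x] := rat_in_itvoo xp.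
  have [a2 /itvP a2y] := rat_in_itvoo ym.
  have [b2 /itvP b2y] := rat_in_itvoo yp.
  exists ((a1, b1), (a2, b2)) => /=; last first.
    by split => /=; rewrite in_itv/= ?a1x ?b1x ?a2y ?b2y.
  move=> [s t] [/=]; rewrite !in_itv/= => /andP[s1 s2] /andP[t1 t2].
  apply: eO; split => /=; rewrite /ball/= ltr_distlC.
    by rewrite (lt_trans _ s1) ?a1x// (lt_trans s2) ?b1x.
  by rewrite (lt_trans _ t1) ?a2y// (lt_trans t2) ?b2y.
rewrite bigcup_mkcond; apply: countable_bigcupT_measurable => // q.
by case: ifP => // _; apply: measurableX; exact: measurable_itv.
Qed.

Definition lebesgue_domain (Omega : smooth_bounded_domain) :
    {measure set plane -> \bar R} :=
  mrestr (lebesgue_measure \x lebesgue_measure)%E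
    (open_measurable_plane (@domain_open Omega)).

Definition L2 (Omega : smooth_bounded_domain) : lmodType R :=
  LfunType (lebesgue_domain Omega) (lee1n 2).

Definition L2ip (Omega : smooth_bounded_domain) (f g : L2 Omega) : R :=
  \int[lebesgue_domain Omega]_x
    ((f : LfunType (lebesgue_domain Omega) (lee1n 2)) x *
     (g : LfunType (lebesgue_domain Omega) (lee1n 2)) x).

End SmoothDomain.
Arguments smooth_bounded_domain : clear implicits.

Section Operators.
Context {R : realType} {X : lmodType R} (ip : X -> X -> R).
Implicit Types (x y u v w : X) (a r lambda : R) (gamma : R^nat).

Definition nrm x := Num.sqrt (ip x x).

Definition cvg_nrm (f : nat -> X) x := nrm (f n - x) @[n --> \oo] --> (0 : R).

Record operator := Operator { dom : set X ; opfun :> X -> X }.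
Implicit Types A : operator.

Definition linear_operator A :=
  dom A 0 /\
  forall a u v, dom A u -> dom A v ->
    dom A (a *: u + v) /\ nrm (A (a *: u + v) - (a *: A u + A v)) = 0.

Definition dense_domain A :=
  forall x (e : R), 0 < e -> exists2 u, dom A u & nrm (u - x) < e.

Definition adjoint_graph A v w := forall u, dom A u -> ip (A u) v = ip u w.

Definition selfadjoint A :=
  [/\ linear_operator A, dense_domain A &
      forall v w, adjoint_graph A v w <-> dom A v /\ nrm (A v - w) = 0].

Definition strictly_positive A :=
  forall u, dom A u -> nrm u != 0 -> 0 < ip (A u) u.

(* [B] is the bounded everywhere defined inverse of [A - lambda].  The spectrum
   of a selfadjoint operator being real, only real [lambda] are considered. *)
Definition resolvent_set A : set R :=
  [set lambda | exists B : X -> X,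
     [/\ exists C : R, forall y, nrm (B y) <= C * nrm y,
         forall y, dom A (B y) /\ nrm (A (B y) - lambda *: B y - y) = 0 &
         forall u, dom A u -> nrm (B (A u - lambda *: u) - u) = 0]].

Definition spectrum A : set R := ~` resolvent_set A.

Definition eigenspace A lambda : set X :=
  [set u | dom A u /\ nrm (A u - lambda *: u) = 0].

Definition eigenvalue A lambda := exists2 u, eigenspace A lambda u & nrm u != 0.

(* [gamma] may list an eigenvalue several times. *)
Definition discrete_spectrum A gamma :=
  [/\ spectrum A = range gamma,
      forall n, eigenvalue A (gamma n),
      forall n, 0 < gamma n &
      gamma n @[n --> \oo] --> +oo].

(* [p] is the orthogonal projection of [u] on the eigenspace of [lambda]. *)
Definition eigenprojection A lambda u p :=
  eigenspace A lambda p /\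
  forall v, eigenspace A lambda v -> ip (u - p) v = 0.

(* Functional calculus: [A^r u] is the sum over the distinct eigenvalues
   [lambda] of [lambda^r P_lambda u]; an eigenvalue repeated in [gamma] is
   counted at its first occurrence only. *)
Definition power_graph A gamma r u w :=
  exists2 p : nat -> X, forall n, eigenprojection A (gamma n) u (p n) &
    cvg_nrm (fun N =>
      \sum_(n < N | gamma n \notin [seq gamma k | k <- iota 0 n])
        (gamma n `^ r) *: p n) w.

Definition power A gamma r : operator :=
  Operator [set u | exists w, power_graph A gamma r u w]
           (fun u => xget 0 (power_graph A gamma r u)).

End Operators.

Section WeightedSpaces.
Context {R : realType} {X : lmodType R} (ip : X -> X -> R).
Variables (A : operator (X := X)) (gamma : R^nat).
Implicit Types (k : R -> R) (r : R) (eta zeta : R -> X) (u v : X).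

Notation Apow := (power ip A gamma).
Notation nrm := (nrm ip).
Notation Rplus := (`]0%R, +oo[%classic : set R).

Definition Hspace r : set X := dom (Apow (r / 2)).

Definition Hnorm r u := nrm (Apow (r / 2) u).

Definition simple_fun (f : R -> X) :=
  exists (m : nat) (E : 'I_m -> set R) (x : 'I_m -> X),
    (forall i, measurable (E i)) /\
    forall s, f s = \sum_(i < m) \1_(E i) s *: x i.

Definition strongly_measurable (f : R -> X) :=
  exists2 g : nat -> R -> X, forall n, simple_fun (g n) &
    forall s, 0 < s -> cvg_nrm ip (fun n => g n s) (f s).

Definition wnorm2 k r eta : \bar R :=
  (\int[lebesgue_measure]_(s in Rplus) (k s * Hnorm r (eta s) ^+ 2)%:E)%E.

(* L^2_k(R^+, H^r); [A^(r/2)] is an isometry from H^r onto its image in L^2,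
   so strong measurability in H^r is that of [A^(r/2) eta]. *)
Definition wspace k r eta :=
  [/\ forall s, 0 < s -> Hspace r (eta s),
      strongly_measurable (fun s => Apow (r / 2) (eta s)) &
      (wnorm2 k r eta < +oo)%E].

Definition test_function (phi : R -> R) :=
  smooth phi /\
  exists a b : R, 0 < a /\ forall s, ~ (a <= s <= b) -> phi s = 0.

Definition weak_derivative zeta zeta' :=
  forall v,
  [/\ locally_integrable Rplus (fun s => ip (zeta s) v),
      locally_integrable Rplus (fun s => ip (zeta' s) v) &
      forall phi, test_function phi ->
        \int[lebesgue_measure]_(s in Rplus) (derive1 phi s * ip (zeta s) v) =
        - \int[lebesgue_measure]_(s in Rplus) (phi s * ip (zeta' s) v)].

(* [eta] and its derivative [eta'] are in L^2_k(R^+, H^r) and [eta] vanishes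
   at 0, the latter meaning that some representative [zeta] of the class of
   [eta] tends to 0 in H^r at 0. *)
Definition wderivative k r eta eta' :=
  [/\ wspace k r eta, wspace k r eta' &
      exists zeta,
      [/\ wspace k r zeta, wnorm2 k r (zeta - eta) = 0%E,
          weak_derivative zeta eta' &
          Hnorm r (zeta s) @[s --> 0^'+] --> (0 : R)]].

(* [Phi], an element of H^0, is the integral of [k(s) A^r eta(s)], which for
   [eta] in L^2_k(R^+, H^r) is a priori an element of H^{-r}, the dual of H^r:
   <A^r eta(s), v> = <A^(r/2) eta(s), A^(r/2) v> for [v] in H^r. *)
Definition wintegral k r eta (Phi : X) :=
  forall v, Hspace r v ->
    ip Phi v =
    \int[lebesgue_measure]_(s in Rplus)
      (k s * ip (Apow (r / 2) (eta s)) (Apow (r / 2) v)).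

End WeightedSpaces.

(* A space is given by a vector space [V] of representatives, the set [D] of
   those which belong to the space, and the norm [N] on [D]. *)
Section Semigroups.
Context {R : realType} {V : lmodType R} (D : set V) (N : V -> R).
Implicit Types (S : R -> V -> V) (L : V -> V -> Prop).

Definition contraction_semigroup S :=
  [/\ forall t z, 0 <= t -> D z -> D (S t z) /\ N (S t z) <= N z,
      forall t a z w, 0 <= t -> D z -> D w ->
        N (S t (a *: z + w) - (a *: S t z + S t w)) = 0,
      forall z, D z -> N (S 0 z - z) = 0,
      forall s t z, 0 <= s -> 0 <= t -> D z ->
        N (S (s + t) z - S s (S t z)) = 0 &
      forall z, D z -> N (S t z - z) @[t --> 0^'+] --> (0 : R)].

Definition generator S (z w : V) :=
  [/\ D z, D w & N (h^-1 *: (S h z - z) - w) @[h --> 0^'+] --> (0 : R)].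

Definition closure_graph L (z w : V) :=
  [/\ D z, D w & forall e : R, 0 < e ->
     exists z' w', [/\ L z' w', N (z' - z) < e & N (w' - w) < e]].

Definition exponentially_stable S :=
  exists M omega : R, [/\ 1 <= M, 0 < omega &
    forall t z, 0 <= t -> D z -> N (S t z) <= M * expR (- omega * t) * N z].

End Semigroups.

Section System.
Context {R : realType} {X : lmodType R} (ip : X -> X -> R).
Variables (A : operator (X := X)) (gamma : R^nat) (alpha sigma : R).
Variables (mu beta : R -> R).

Notation Apow := (power ip A gamma).
Notation H r := (Hspace ip A gamma r).

Definition state : lmodType R := (X * X * X * (R -> X) * (R -> X))%type.

Definition phase_space : set state :=
  [set z | let: (u, v, theta, eta, xi) := z in
     [/\ H 2 u, wspace ip A gamma mu alpha eta & wspace ip A gamma beta 2 xi]].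

Definition phase_norm (z : state) : R :=
  let: (u, v, theta, eta, xi) := z in
  Num.sqrt (Hnorm ip A gamma 2 u ^+ 2 + nrm ip v ^+ 2 + nrm ip theta ^+ 2
            + fine (wnorm2 ip A gamma mu alpha eta)
            + fine (wnorm2 ip A gamma beta 2 xi)).

(* The graph of the operator [L].  [Ieta] and [Ixi] are the integrals of
   [mu A^alpha eta] and [beta A^2 xi]; [eta'] and [xi'] are [- T eta] and
   [- T' xi].  The condition [Au \in H^2 = D(A)] is [dom A (A u)]. *)
Definition system_graph (z w : state) :=
  let: (u, v, theta, eta, xi) := z in
  [/\ phase_space z,
      dom A u /\ dom A (A u),
      H (2 * sigma) v /\ H (2 * sigma) theta &
      exists (Ieta Ixi : X) (eta' xi' : R -> X),
      [/\ wintegral ip A gamma mu alpha eta Ieta,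
          wintegral ip A gamma beta 2 xi Ixi,
          wderivative ip A gamma mu alpha eta eta',
          wderivative ip A gamma beta 2 xi xi' &
          let Lz : state :=
            (v,
             - Ixi - A (A u) + Apow sigma theta,
             - Ieta - Apow sigma v,
             (fun s => - eta' s + theta),
             (fun s => - xi' s + v)) in
          [/\ phase_space Lz, phase_space w & phase_norm (w - Lz) = 0]]].

Definition solution_semigroup (S : R -> state -> state) :=
  contraction_semigroup phase_space phase_norm S /\
  forall z w, generator phase_space phase_norm S z w <->
              closure_graph phase_space phase_norm system_graph z w.

End System.

(* Main.v *)
Require Import Defs.
From HB Require Import structures.
From mathcomp Require Import all_boot all_order all_algebra.
From mathcomp Require Import all_classical all_reals all_analysis.
From mathcomp Require Import measurable_realfun ring lra.

Set Implicit Arguments.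
Unset Strict Implicit.
Unset Printing Implicit Defensive.

Import Order.TTheory GRing.Theory Num.Theory.
Import numFieldNormedType.Exports.

Local Open Scope classical_set_scope.
Local Open Scope ring_scope.

(** Along an eigenvector [e] of [A] with eigenvalue [g], [u] is an oscillator of
frequency [g].  So is [theta], with squared frequency [g^alpha m0] where [m0] is
the integral of [mu], if [eta] is taken to be the time primitive of [theta], its
delayed part being neglected; [A^sigma] couples the two.  The
squared frequencies [x] of the pair are the roots of
[(x - g^2) (x - g^alpha m0) = x g^(2 sigma)].  The larger root is
above [g^2] ([resonant_frequency]); let [lambda] be its square root.  What has
been neglected amounts to the Fourier integral of [mu] at frequency [lambda]; it
is of order [lambda^(omega1 - 1)] since [mu] is decreasing and behaves as
[s^(-omega1)] at [0] ([oscillatory_bound]).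
The undamped oscillation of frequency [lambda] therefore solves the system up
to an error of order
[g^alpha lambda^(omega1 - 2) <= g^(alpha + omega1 - 2)], which tends to [0] as
[g] grows because [omega1 < 2 - alpha], while the [theta] component of the
state keeps norm [1] ([quasimode_estimate]).

The spaces being real, an oscillation is a pair [a], [b] of states with
[L a = - lambda b + r1] and [L b = lambda a + r2].  For a contraction semigroup
such a pair satisfies
[N a + N b <= 2 (N (S T a) + N (S T b)) + 2 T (N r1 + N r2)]
for every [T > 0] ([quasimode_lower_bound]).  Under exponential
stability one [T], the same for all eigenvalues, makes the first term at most
half of the left-hand side, and the second one tends to [0] with growing
eigenvalue although the left-hand side is at least [1]. *)

(** * Semi-inner products *)

(** The inner product of [L^2] acts on functions, not on classes, hence is
only semi-definite; a difference of norm [0] stands for equality of vectors. *)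
Definition semi_inner_product (R : realType) (X : lmodType R)
    (ip : X -> X -> R) :=
  [/\ forall x y, ip x y = ip y x,
      forall a x y z, ip (a *: x + y) z = a * ip x z + ip y z &
      forall x, 0 <= ip x x].

Section SemiInnerProduct.
Context {R : realType} {X : lmodType R} (ip : X -> X -> R).
Hypothesis ipP : semi_inner_product ip.
Implicit Types (x y z u v w : X) (a b : R).

Let ipC x y : ip x y = ip y x. Proof. by have [] := ipP. Qed.
Let ipL a x y z : ip (a *: x + y) z = a * ip x z + ip y z.
Proof. by have [_ ->] := ipP. Qed.
Let ip_ge0 x : 0 <= ip x x. Proof. by have [] := ipP. Qed.

Lemma ipDl x y z : ip (x + y) z = ip x z + ip y z.
Proof. by rewrite -[x]scale1r ipL mul1r scale1r. Qed.

Lemma ip0l z : ip 0 z = 0.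
Proof. by have := ipDl 0 0 z; rewrite addr0; lra. Qed.

Lemma ipZl a x z : ip (a *: x) z = a * ip x z.
Proof. by rewrite -[a *: x]addr0 ipL ip0l addr0. Qed.

Lemma ipBl x y z : ip (x - y) z = ip x z - ip y z.
Proof. by rewrite ipDl -scaleN1r ipZl mulN1r. Qed.

Lemma ipDr x y z : ip z (x + y) = ip z x + ip z y.
Proof. by rewrite !(ipC z) ipDl. Qed.

Lemma ipZr a x z : ip z (a *: x) = a * ip z x.
Proof. by rewrite !(ipC z) ipZl. Qed.

Lemma ipBr x y z : ip z (x - y) = ip z x - ip z y.
Proof. by rewrite !(ipC z) ipBl. Qed.

Lemma ip0r z : ip z 0 = 0. Proof. by rewrite ipC ip0l. Qed.

Lemma nrm_ge0 x : 0 <= nrm ip x. Proof. exact: sqrtr_ge0. Qed.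

Lemma sqr_nrm x : nrm ip x ^+ 2 = ip x x.
Proof. by rewrite sqr_sqrtr. Qed.

Lemma CauchySchwarz x y : `|ip x y| <= nrm ip x * nrm ip y.
Proof.
rewrite -[leRHS]ger0_norm ?mulr_ge0 ?nrm_ge0// -ler_sqr ?nnegrE//.
rewrite !real_normK ?num_real// exprMn !sqr_nrm.
have quad t : 0 <= t ^+ 2 * ip x x + 2 * t * ip x y + ip y y.
  have := ip_ge0 (t *: x + y).
  by congr (0 <= _); rewrite ipDl !ipDr !ipZl !ipZr (ipC y x); ring.
have [xx0|xx0] := eqVneq (ip x x) 0.
  have [-> |xy0] := eqVneq (ip x y) 0; first by rewrite expr0n xx0 mul0r.
  have := quad (- (ip y y + 1) / (2 * ip x y)).
  rewrite xx0 mulr0 add0r.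
  have -> : 2 * (- (ip y y + 1) / (2 * ip x y)) * ip x y = - (ip y y + 1).
    by field.
  by have := ip_ge0 y; lra.
have xxp : 0 < ip x x by rewrite lt_neqAle eq_sym xx0 ip_ge0.
have := quad (- ip x y / ip x x).
have -> : (- ip x y / ip x x) ^+ 2 * ip x x + 2 * (- ip x y / ip x x) * ip x y
          + ip y y = (ip x x * ip y y - ip x y ^+ 2) / ip x x by field.
by rewrite pmulr_lge0 ?invr_gt0// subr_ge0.
Qed.

Lemma ip_null x y : nrm ip x = 0 -> ip x y = 0.
Proof.
by move=> x0; apply/eqP; rewrite -normr_le0 (le_trans (CauchySchwarz x y))// x0 mul0r.
Qed.

Lemma nrmD x y : nrm ip (x + y) <= nrm ip x + nrm ip y.
Proof.
rewrite -ler_sqr ?nnegrE ?addr_ge0 ?nrm_ge0// sqrrD !sqr_nrm ipDl !ipDr.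
have := CauchySchwarz x y; rewrite ler_norml => /andP[_]; rewrite (ipC y x) => h.
lra.
Qed.

Lemma nrmZ a x : nrm ip (a *: x) = `|a| * nrm ip x.
Proof.
by rewrite /nrm ipZl ipZr mulrA -expr2 sqrtrM ?sqr_ge0// sqrtr_sqr.
Qed.

Lemma nrm0 : nrm ip 0 = 0. Proof. by rewrite /nrm ip0l sqrtr0. Qed.

Lemma nrmN x : nrm ip (- x) = nrm ip x.
Proof. by rewrite -scaleN1r nrmZ normrN1 mul1r. Qed.

Lemma nrmBC x y : nrm ip (x - y) = nrm ip (y - x).
Proof. by rewrite -nrmN opprB. Qed.

Lemma null_trans y x z :
  nrm ip (x - y) = 0 -> nrm ip (y - z) = 0 -> nrm ip (x - z) = 0.
Proof.
move=> xy yz; apply/eqP; rewrite eq_le nrm_ge0 andbT.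
by rewrite -(subrKA y) (le_trans (nrmD _ _))// xy yz addr0.
Qed.

Lemma null_lin a x y x' y' : nrm ip (x - x') = 0 -> nrm ip (y - y') = 0 ->
  nrm ip (a *: x + y - (a *: x' + y')) = 0.
Proof.
move=> xx yy; apply/eqP; rewrite eq_le nrm_ge0 andbT.
by rewrite opprD addrACA -scalerBr (le_trans (nrmD _ _))// nrmZ xx yy mulr0 addr0.
Qed.

Lemma null_ip x y z : nrm ip (x - y) = 0 -> ip x z = ip y z.
Proof. by move=> xy; apply/eqP; rewrite -subr_eq0 -ipBl ip_null. Qed.

Lemma null_nrm x y : nrm ip (x - y) = 0 -> nrm ip x = nrm ip y.
Proof. by move=> xy; rewrite /nrm (null_ip _ xy) ipC (null_ip _ xy). Qed.

Lemma cvg_nrm_unique (f : nat -> X) x y :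
  cvg_nrm ip f x -> cvg_nrm ip f y -> nrm ip (x - y) = 0.
Proof.
move=> fx fy; apply/eqP; rewrite eq_le nrm_ge0 andbT.
have h : nrm ip (f n - x) + nrm ip (f n - y) @[n --> \oo] --> (0 : R).
  by rewrite -[X in _ --> X](addr0 0); apply: cvgD.
rewrite -(cvg_lim _ h)//; apply: limr_ge; first by apply/cvg_ex; exists 0.
near=> n; rewrite -(subrKA (f n)) (le_trans (nrmD _ _))// lerD2r nrmBC//.
Unshelve. all: by end_near. Qed.

Lemma cvg_nrm_lin (f g : nat -> X) x y a : cvg_nrm ip f x -> cvg_nrm ip g y ->
  cvg_nrm ip (fun n => a *: f n + g n) (a *: x + y).
Proof.
move=> fx gy.
have h : `|a| * nrm ip (f n - x) + nrm ip (g n - y) @[n --> \oo] --> (0 : R).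
  by rewrite -[X in _ --> X](addr0 0) -[X in X + _](mulr0 `|a|);
     apply: cvgD => //; apply: cvgMr.
apply: (squeeze_cvgr _ (cvg_cst 0) h).
apply: nearW => n; rewrite nrm_ge0/= opprD addrACA -scalerBr.
by rewrite (le_trans (nrmD _ _))// nrmZ.
Qed.

Lemma eq_cvg_nrm (f g : nat -> X) x y :
  (\forall n \near \oo, nrm ip (f n - g n) = 0) -> nrm ip (x - y) = 0 ->
  cvg_nrm ip f x -> cvg_nrm ip g y.
Proof.
move=> fg xy; apply: cvg_trans; apply: near_eq_cvg; near=> n.
have fgn : nrm ip (f n - g n) = 0 by near: n.
by apply: null_nrm; have := null_lin (-1) xy fgn;
   rewrite !scaleN1r ![- _ + _]addrC.
Unshelve. all: by end_near. Qed.

Lemma cvg_nrm_ip (f : nat -> X) x y :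
  cvg_nrm ip f x -> ip y (f n) @[n --> \oo] --> ip y x.
Proof.
move=> fx; apply/subr_cvg0.
have h : nrm ip y * nrm ip (f n - x) @[n --> \oo] --> (0 : R).
  by rewrite -[X in _ --> X](mulr0 (nrm ip y)); apply: cvgMr.
apply/norm_cvg0P; apply: (squeeze_cvgr _ (cvg_cst 0) h).
by apply: nearW => n /=; rewrite normr_ge0 -ipBr CauchySchwarz.
Qed.

End SemiInnerProduct.

(** * Spectral powers of the operator *)
Section Spectral.
Context {R : realType} {X : lmodType R} (ip : X -> X -> R).
Hypothesis ipP : semi_inner_product ip.
Variables (A : operator (X := X)) (gamma : R^nat).
Hypothesis selfadjA : selfadjoint ip A.
Implicit Types (x y z u v w e p q : X) (a b r lambda : R).

Let ipC x y : ip x y = ip y x. Proof. by have [] := ipP. Qed.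

Local Notation eigenspace := (Defs.eigenspace ip A).
Local Notation Apow := (power ip A gamma).

Lemma operator_symmetric u v : dom A u -> dom A v -> ip (A u) v = ip u (A v).
Proof.
have [_ _ adj] := selfadjA; move=> Au Av.
by have [_ /(_ _ u Au)] := adj v (A v); apply; split; rewrite // subrr nrm0.
Qed.

(** The adjoint graph does not see null vectors, so neither do the domain and
the values of a selfadjoint operator. *)
Lemma operator_null u v : nrm ip (u - v) = 0 -> dom A u ->
  dom A v /\ nrm ip (A v - A u) = 0.
Proof.
have [_ _ adj] := selfadjA; move=> uv Au.
apply/adj => w Aw; rewrite ipC (_ : ip v _ = ip u (A w)); last first.
  by rewrite (null_ip ipP _ uv).
by rewrite ipC operator_symmetric.
Qed.

Lemma eigenspace_lin a lambda u v : eigenspace lambda u ->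
  eigenspace lambda v -> eigenspace lambda (a *: u + v).
Proof.
have [[_ lin] _ _] := selfadjA.
move=> [Au eu] [Av ev]; have [Auv euv] := lin a u v Au Av; split => //.
apply: (null_trans ipP euv).
by rewrite scalerDr scalerA (mulrC lambda) -scalerA; exact: null_lin.
Qed.

Lemma eigenspace0 lambda : eigenspace lambda 0.
Proof.
have [[A0 lin] _ _] := selfadjA; split => //.
have [_] := lin 0 0 0 A0 A0.
rewrite !scale0r !add0r subrr => _.
have [_] := lin 1 0 0 A0 A0; rewrite !scale1r !addr0 scaler0 subr0.
by rewrite opprD addNKr nrmN.
Qed.

Lemma eigenspaceZ a lambda u :
  eigenspace lambda u -> eigenspace lambda (a *: u).
Proof. by move=> eu; rewrite -[_ *: _]addr0; apply: eigenspace_lin => //; exact: eigenspace0. Qed.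

Lemma eigenspace_orthogonal lambda mu u v : lambda != mu ->
  eigenspace lambda u -> eigenspace mu v -> ip u v = 0.
Proof.
move=> lm [Au eu] [Av ev]; have := operator_symmetric Au Av.
rewrite (null_ip ipP _ eu) (ipC u) (null_ip ipP _ ev) !ipZl// (ipC v u).
move=> /eqP; rewrite -subr_eq0 -mulrBl mulf_eq0 subr_eq0 (negPf lm) => /eqP//.
Qed.

Lemma eigenprojection_lin a lambda u v p q :
  eigenprojection ip A lambda u p -> eigenprojection ip A lambda v q ->
  eigenprojection ip A lambda (a *: u + v) (a *: p + q).
Proof.
move=> [ep up] [eq vq]; split; first exact: eigenspace_lin.
move=> w ew; rewrite opprD addrACA -scalerBr ipDl// ipZl//.
by rewrite up// vq// mulr0 addr0.
Qed.

(** The difference of the projections is an eigenvector orthogonal to itself. *)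
Lemma eigenprojection_unique lambda u u' p p' : nrm ip (u - u') = 0 ->
  eigenprojection ip A lambda u p -> eigenprojection ip A lambda u' p' ->
  nrm ip (p - p') = 0.
Proof.
move=> uu [ep up] [ep' up'].
have epp : eigenspace lambda (p - p').
  by rewrite addrC -scaleN1r; exact: eigenspace_lin.
rewrite /nrm ipBl//.
have -> : ip p (p - p') = ip u (p - p').
  by apply/esym/eqP; rewrite -subr_eq0 -ipBl// up.
have -> : ip p' (p - p') = ip u' (p - p').
  by apply/esym/eqP; rewrite -subr_eq0 -ipBl// up'.
by rewrite (null_ip ipP _ uu) subrr sqrtr0.
Qed.

Lemma power_graph_lin r a u v w z :
  power_graph ip A gamma r u w -> power_graph ip A gamma r v z ->
  power_graph ip A gamma r (a *: u + v) (a *: w + z).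
Proof.
move=> [p pu pw] [q qv qz]; exists (fun n => a *: p n + q n).
  by move=> n; exact: eigenprojection_lin.
have := cvg_nrm_lin ipP a pw qz; apply: eq_cvg_nrm => //; last by rewrite subrr nrm0.
apply: nearW => N; rewrite scaler_sumr -big_split/=.
rewrite (eq_bigr (fun n : 'I_N => gamma n `^ r *: (a *: p n + q n))) ?subrr ?nrm0//.
by move=> n _; rewrite scalerDr !scalerA mulrC.
Qed.

Lemma null_sum (I : Type) (s : seq I) (P : pred I) (F G : I -> X) :
  (forall i, P i -> nrm ip (F i - G i) = 0) ->
  nrm ip (\sum_(i <- s | P i) F i - \sum_(i <- s | P i) G i) = 0.
Proof.
move=> FG; elim/big_ind2 : _ => //; first by rewrite subrr nrm0.
move=> x x' y y' xx yy.
by have := null_lin ipP 1 xx yy; rewrite !scale1r.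
Qed.

Lemma null_scale a u v : nrm ip (u - v) = 0 -> nrm ip (a *: u - a *: v) = 0.
Proof. by move=> uv; rewrite -scalerBr nrmZ// uv mulr0. Qed.

Lemma power_graph_unique r u u' w w' : nrm ip (u - u') = 0 ->
  power_graph ip A gamma r u w -> power_graph ip A gamma r u' w' ->
  nrm ip (w - w') = 0.
Proof.
move=> uu [p pu pw] [q qu qw]; apply: (cvg_nrm_unique ipP pw).
have := qw; apply: eq_cvg_nrm => //; last by rewrite subrr nrm0.
apply: nearW => N; apply: null_sum => n _; apply: null_scale.
by apply: eigenprojection_unique (qu n) (pu n); rewrite nrmBC.
Qed.

Lemma power_graphP r u : dom (Apow r) u -> power_graph ip A gamma r u (Apow r u).
Proof. by move=> [w uw]; exact: (xgetPex 0 (ex_intro _ w uw)). Qed.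

Lemma power_lin r a u v : dom (Apow r) u -> dom (Apow r) v ->
  dom (Apow r) (a *: u + v) /\
  nrm ip (Apow r (a *: u + v) - (a *: Apow r u + Apow r v)) = 0.
Proof.
move=> /power_graphP ru /power_graphP rv.
have rl := power_graph_lin a ru rv.
have dl : dom (Apow r) (a *: u + v) by eexists; exact: rl.
split=> //; apply: power_graph_unique (power_graphP dl) rl.
by rewrite subrr nrm0.
Qed.

(** The eigenvalues may be listed with repetitions; [n0] is the index at which
the defining sum of [power_graph] counts [gamma m]. *)
Lemma first_occurrence m : exists2 n0, gamma n0 = gamma m &
  forall n, gamma n = gamma m ->
    (gamma n \notin [seq gamma k | k <- iota 0 n]) = (n == n0).
Proof.
have ex : exists n, gamma n == gamma m by exists m.
exists (ex_minn ex) => [|n nm]; case: ex_minnP => n0 /eqP n0m n0min//.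
have : (n0 <= n)%N by rewrite n0min// nm.
rewrite leq_eqVlt => /predU1P[<-|lt].
  rewrite eqxx; apply/mapP => -[k]; rewrite mem_iota/= add0n => kn km.
  by have := n0min k; rewrite -km n0m eqxx leqNgt kn => /(_ isT).
rewrite gtn_eqF//; apply/negbTE; rewrite negbK; apply/mapP.
by exists n0; rewrite ?mem_iota ?add0n// n0m.
Qed.

(** A sum over the distinct eigenvalues which is supported on one of them is
eventually constant. *)
Lemma spectral_sum (V : nmodType) m (F : nat -> V) c :
  (forall n, gamma n != gamma m -> F n = 0) ->
  (forall n, gamma n = gamma m -> F n = c) ->
  \forall N \near \oo,
    \sum_(n < N | gamma n \notin [seq gamma k | k <- iota 0 n]) F n = c.
Proof.
move=> F0 Fc; have [n0 n0m n0P] := first_occurrence m.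
near=> N; have ltn0N : (n0 < N)%N by near: N; exact: nbhs_infty_gt.
rewrite (bigD1 (Ordinal ltn0N))/=; last by rewrite n0P.
rewrite Fc// big1 ?addr0// => n /andP[+ nn0].
have [nm|/F0//] := eqVneq (gamma n) (gamma m).
by rewrite n0P// => /eqP nE; move: nn0; rewrite -val_eqE/= nE eqxx.
Unshelve. all: by end_near. Qed.

Lemma power_graph_eigen r m e : eigenspace (gamma m) e ->
  power_graph ip A gamma r e (gamma m `^ r *: e).
Proof.
move=> ee; exists (fun n => if gamma n == gamma m then e else 0).
  move=> n; have [->|nm] := eqVneq (gamma n) (gamma m).
    by split=> // v _; rewrite subrr ip0l.
  split; first exact: eigenspace0.
  by move=> v ev; rewrite subr0 (eigenspace_orthogonal _ ee ev)// eq_sym.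
apply: cvg_near_cst.
pose F n := gamma n `^ r *: (if gamma n == gamma m then e else 0).
apply: filterS (@spectral_sum _ m F (gamma m `^ r *: e) _ _); rewrite /F.
- by move=> N ->; rewrite subrr nrm0.
- by move=> n /negPf ->; rewrite scaler0.
- by move=> n ->; rewrite eqxx.
Qed.

Lemma power_eigen r m e : eigenspace (gamma m) e ->
  dom (Apow r) e /\ nrm ip (Apow r e - gamma m `^ r *: e) = 0.
Proof.
move=> ee; have re := power_graph_eigen r ee.
have de : dom (Apow r) e by eexists; exact: re.
split=> //; apply: power_graph_unique (power_graphP de) re.
by rewrite subrr nrm0.
Qed.

(** The partial sums defining [A^r v] have constant inner product with [e] once
the eigenvalue of [e] has been counted. *)
Lemma ip_power r m e v : eigenspace (gamma m) e -> dom (Apow r) v ->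
  ip e (Apow r v) = gamma m `^ r * ip e v.
Proof.
move=> ee /power_graphP[p pv pw]; have h := cvg_nrm_ip ipP (y := e) pw.
rewrite -(cvg_lim _ h)//; apply: cvg_lim => //; apply: cvg_near_cst.
pose F n := gamma n `^ r * ip e (p n).
apply: filterS (@spectral_sum _ m F (gamma m `^ r * ip e v) _ _).
- move=> N <-; elim/big_rec2 : _ => [|n y x _ <-]; first by rewrite ip0r.
  by rewrite ipDr// ipZr.
- move=> n nm; rewrite /F (eigenspace_orthogonal _ ee (pv n).1) ?mulr0//.
  by rewrite eq_sym.
- move=> n nm; rewrite /F nm; congr (_ * _); have [_ +] := pv n.
  rewrite nm => /(_ e ee)/eqP; rewrite ipBl// subr_eq0 => /eqP vp.
  by rewrite ipC -vp ipC.
Qed.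

End Spectral.

(** * Measurability of vector-valued functions *)
Section Measurability.
Context {R : realType} {X : lmodType R} (ip : X -> X -> R).
Hypothesis ipP : semi_inner_product ip.
Implicit Types (f g : R -> X) (a : R).
Local Notation Rplus := (`]0%R, +oo[%classic : set R).

Lemma simple_fun_lin f g a :
  simple_fun f -> simple_fun g -> simple_fun (fun s => a *: f s + g s).
Proof.
move=> [m [E [x [mE fE]]]] [n [F [y [mF gE]]]].
exists (m + n)%N, (fun i => match fintype.split i with inl j => E j | inr j => F j end),
  (fun i => match fintype.split i with inl j => a *: x j | inr j => y j end); split.
  by move=> i; case: fintype.split.
move=> s; rewrite big_split_ord/= fE gE scaler_sumr; congr (_ + _).
  apply: eq_bigr => i _; rewrite (unsplitK (inl i)) !scalerA mulrC//.
by apply: eq_bigr => i _; rewrite (unsplitK (inr i)).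
Qed.

Lemma strongly_measurable_lin f g h a :
  strongly_measurable ip f -> strongly_measurable ip g ->
  (forall s, 0 < s -> nrm ip (h s - (a *: f s + g s)) = 0) ->
  strongly_measurable ip h.
Proof.
move=> [u su uf] [v sv vg] hE.
exists (fun n s => a *: u n s + v n s) => [n|s s0]; first exact: simple_fun_lin.
have := cvg_nrm_lin ipP a (uf s s0) (vg s s0).
apply: eq_cvg_nrm => //; last by rewrite nrmBC ?hE.
by apply: nearW => n; rewrite subrr nrm0.
Qed.

Lemma measurable_nrm_simple f : simple_fun f ->
  measurable_fun setT (fun s => nrm ip (f s)).
Proof.
move=> [m [E [x [mE fE]]]].
have -> : (fun s => nrm ip (f s)) = (fun s => Num.sqrt
    (\sum_(i < m) \sum_(j < m) \1_(E i) s * \1_(E j) s * ip (x i) (x j))).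
  apply/funext => s; rewrite /nrm fE; congr Num.sqrt.
  rewrite (big_morph (fun u => ip u _) (fun u v => ipDl ipP u v _) (ip0l ipP _)).
  apply: eq_bigr => i _.
  rewrite (big_morph (ip _) (fun u v => ipDr ipP u v _) (ip0r ipP _)).
  by apply: eq_bigr => j _; rewrite ipZl// ipZr// mulrA.
apply: measurableT_comp.
  by apply: continuous_measurable_fun; exact: sqrt_continuous.
apply: measurable_sum => i; apply: measurable_sum => j.
by apply: measurable_funM => //; apply: measurable_funM; apply: measurable_indic.
Qed.

Lemma strongly_measurable_nrm f : strongly_measurable ip f ->
  measurable_fun Rplus (fun s => nrm ip (f s)).
Proof.
move=> [g sg gf].
apply: (@measurable_fun_cvg _ _ _ _ (fun n s => nrm ip (g n s))) => [n|s].
  by apply: measurable_funTS; exact: measurable_nrm_simple.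
rewrite /= in_itv/= andbT => s0; apply/subr_cvg0/norm_cvg0P.
apply: (squeeze_cvgr _ (cvg_cst 0) (gf s s0)); apply: nearW => n /=.
rewrite normr_ge0/= ler_norml.
have h1 := nrmD ipP (f s - g n s) (g n s); have h2 := nrmD ipP (g n s - f s) (f s).
move: h1 h2; rewrite !subrK (nrmBC ipP (f s)) => h1 h2.
by apply/andP; split; lra.
Qed.

Import HBSimple.

Lemma strongly_measurable_line (h : R -> R) (e : X) : measurable_fun setT h ->
  strongly_measurable ip (fun s => h s *: e).
Proof.
move=> mh.
have [g gh] := @approximation_sfun _ _ R (EFin \o h) setT measurableT
  (proj2 (measurable_EFinP _ _) mh).
exists (fun n s => g n s *: e) => [n|s s0].
  have [s sE] : exists s : seq R, forall x, g n x = \sum_(y <- s) y * \1_(g n @^-1` [set y]) x.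
    exists (finmap.enum_fset (fset_set (range (g n)))) => x.
    by rewrite {1}fimfunE fsbig_finite.
  exists (size s), (fun i => g n @^-1` [set s`_i]), (fun i => s`_i *: e); split.
    by move=> i; exact: measurable_sfunP.
  move=> t; rewrite sE scaler_suml (big_nth 0) big_mkord.
  by apply: eq_bigr => i _; rewrite scalerA mulrC.
have /fine_cvgP[_ /= hs] := gh s I.
have hs0 : `|g n s - h s| * nrm ip e @[n --> \oo] --> (0 : R).
  rewrite -[X in _ --> X](mul0r (nrm ip e)); apply: cvgMl.
  by apply/norm_cvg0P/subr_cvg0.
apply: cvg_trans hs0; apply: near_eq_cvg; apply: nearW => n.
by rewrite -scalerBl nrmZ.
Qed.

End Measurability.

(** * Weighted spaces *)
Section Weighted.
Context {R : realType} {X : lmodType R} (ip : X -> X -> R).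
Hypothesis ipP : semi_inner_product ip.
Variables (A : operator (X := X)) (gamma : R^nat).
Hypothesis selfadjA : selfadjoint ip A.
Implicit Types (u v : X) (eta zeta : R -> X) (a c r : R) (k : R -> R).
Local Notation Rplus := (`]0%R, +oo[%classic : set R).
Local Notation Apow := (power ip A gamma).
Local Notation Hnorm := (Hnorm ip A gamma).
Local Notation Hspace := (Hspace ip A gamma).
Local Notation wnorm2 := (wnorm2 ip A gamma).
Local Notation wspace := (wspace ip A gamma).

Definition weight k := (forall s, 0 < s -> 0 <= k s) /\ measurable_fun Rplus k.

(** The triangle inequality for a square root of a sum or an integral of squared
seminorms is equivalent to this family of inequalities between squares, indexed
by [c > 0], which is stable under sums and integrals. *)
Lemma sqr_triangle (x y z c : R) : 0 <= x -> 0 < c -> x <= y + z ->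
  x ^+ 2 <= (1 + c) * y ^+ 2 + (1 + c^-1) * z ^+ 2.
Proof.
move=> x0 c0 xyz; apply: (@le_trans _ _ ((y + z) ^+ 2)).
  by rewrite ler_sqr ?nnegrE// (le_trans x0).
rewrite -subr_ge0.
have -> : (1 + c) * y ^+ 2 + (1 + c^-1) * z ^+ 2 - (y + z) ^+ 2 =
          (c * y - z) ^+ 2 / c by field; rewrite gt_eqF.
by rewrite divr_ge0 ?sqr_ge0 ?ltW.
Qed.

(** Converse of [sqr_triangle]: the choice [c = z / y] is optimal. *)
Lemma triangle_sqr (x y z : R) : 0 <= x -> 0 <= y -> 0 <= z ->
  (forall c, 0 < c -> x ^+ 2 <= (1 + c) * y ^+ 2 + (1 + c^-1) * z ^+ 2) ->
  x <= y + z.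
Proof.
move=> x0 y0 z0 H; apply/ler_addgt0Pr => e e0.
(* [y] may vanish: both terms are shifted by [d] before optimizing [c]. *)
pose d := e / 2; have d0 : 0 < d by rewrite divr_gt0.
have -> : y + z + e = (y + d) + (z + d) by rewrite /d; field.
have yd : 0 < y + d by rewrite ltr_wpDl.
have zd : 0 < z + d by rewrite ltr_wpDl.
rewrite -ler_sqr ?nnegrE//; last by rewrite ltW// addr_gt0.
have c0 : 0 < (z + d) / (y + d) by rewrite divr_gt0.
apply: (le_trans (H _ c0)).
have -> : (y + d + (z + d)) ^+ 2 = (1 + (z + d) / (y + d)) * (y + d) ^+ 2 +
   (1 + ((z + d) / (y + d))^-1) * (z + d) ^+ 2 by field; rewrite !gt_eqF.
by apply: lerD; apply: ler_wpM2l; rewrite ?addr_ge0 ?invr_ge0 ?(ltW c0)//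
   ler_sqr ?nnegrE ?(ltW yd) ?(ltW zd)// lerDl ltW.
Qed.

Lemma Hspace_lin r a u v : Hspace r u -> Hspace r v -> Hspace r (a *: u + v).
Proof. by move=> hu hv; have [] := power_lin ipP selfadjA a hu hv. Qed.

Lemma Hnorm_lin r a u v : Hspace r u -> Hspace r v ->
  Hnorm r (a *: u + v) <= `|a| * Hnorm r u + Hnorm r v.
Proof.
move=> hu hv; have [_ /(null_nrm ipP)] := power_lin ipP selfadjA a hu hv.
by rewrite /Defs.Hnorm => ->; rewrite (le_trans (nrmD ipP _ _))// nrmZ.
Qed.

Lemma Hspace0 r : Hspace r 0 /\ Hnorm r 0 = 0.
Proof.
have [h0 h1] := power_eigen ipP selfadjA (r / 2)
  (eigenspace0 ipP selfadjA (gamma 0%N)).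
by split=> //; rewrite scaler0 subr0 in h1.
Qed.

Lemma Hnorm_ge0 r u : 0 <= Hnorm r u. Proof. exact: nrm_ge0. Qed.

Lemma Hnorm_sqr r a u v c : 0 < c -> Hspace r u -> Hspace r v ->
  Hnorm r (a *: u + v) ^+ 2 <=
    (1 + c) * a ^+ 2 * Hnorm r u ^+ 2 + (1 + c^-1) * Hnorm r v ^+ 2.
Proof.
move=> c0 hu hv; rewrite -mulrA -[a ^+ 2]real_normK ?num_real// -exprMn.
by apply: sqr_triangle => //; [exact: Hnorm_ge0|exact: Hnorm_lin].
Qed.

Lemma wspace_measurable k r eta : weight k -> wspace k r eta ->
  measurable_fun Rplus (fun s => (k s * Hnorm r (eta s) ^+ 2)%:E).
Proof.
move=> [_ mk] [_ sm _]; apply/measurable_EFinP; apply: measurable_funM => //.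
by apply: measurable_funX; exact: strongly_measurable_nrm ipP _ sm.
Qed.

Lemma weight_ge0 k r eta s : weight k -> Rplus s ->
  (0 <= (k s * Hnorm r (eta s) ^+ 2)%:E)%E.
Proof.
move=> [k0 _] /=; rewrite in_itv/= andbT => s0.
by rewrite lee_fin mulr_ge0 ?k0// sqr_ge0.
Qed.

Lemma wnorm2_ge0 k r eta : weight k -> (0 <= wnorm2 k r eta)%E.
Proof. by move=> wk; apply: integral_ge0 => s; exact: weight_ge0. Qed.

Lemma wspace_sm k r a eta zeta : wspace k r eta -> wspace k r zeta ->
  strongly_measurable ip (fun s => Apow (r / 2) (a *: eta s + zeta s)).
Proof.
move=> [he se _] [hz sz _]; apply: (@strongly_measurable_lin _ _ _ ipP _ _ _ a se sz) => s s0.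
by have [] := power_lin ipP selfadjA a (he s s0) (hz s s0).
Qed.

Lemma wnorm2_lin k r a eta zeta c : weight k -> 0 < c ->
  wspace k r eta -> wspace k r zeta ->
  (wnorm2 k r (a *: eta + zeta)%R <=
     ((1 + c) * a ^+ 2)%:E * wnorm2 k r eta +
     (1 + c^-1)%:E * wnorm2 k r zeta)%E.
Proof.
move=> wk c0 we wz; have me := wspace_measurable wk we.
have mz := wspace_measurable wk wz.
have c1 : 0 <= (1 + c) * a ^+ 2 by rewrite mulr_ge0 ?sqr_ge0// addr_ge0// ltW.
have c2 : 0 <= 1 + c^-1 by rewrite addr_ge0// invr_ge0 ltW.
have i1 := @ge0_integralZl_EFin _ _ _ lebesgue_measure _ (measurable_itv _) _
  (fun s => @weight_ge0 k r eta s wk) me _ c1.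
have i2 := @ge0_integralZl_EFin _ _ _ lebesgue_measure _ (measurable_itv _) _
  (fun s => @weight_ge0 k r zeta s wk) mz _ c2.
rewrite /Defs.wnorm2 -i1 -i2 -ge0_integralD//; first last.
- exact: measurable_funeM.
- by move=> s Rs; rewrite mule_ge0 ?weight_ge0// lee_fin.
- exact: measurable_funeM.
- by move=> s Rs; rewrite mule_ge0 ?weight_ge0// lee_fin.
have [k0 mk] := wk; have [he _ _] := we; have [hz _ _] := wz.
apply: ge0_le_integral => //.
- by move=> s; exact: weight_ge0.
- apply/measurable_EFinP; apply: measurable_funM => //; apply: measurable_funX.
  have := strongly_measurable_nrm ipP (wspace_sm a we wz).
  exact.
- by apply: emeasurable_funD; exact: measurable_funeM.
move=> s /=; rewrite in_itv/= andbT => s0.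
rewrite -!EFinM -EFinD lee_fin (mulrCA _ (k s)) (mulrCA _ (k s)) -mulrDr.
apply: ler_wpM2l; first exact: k0.
by apply: Hnorm_sqr => //; [exact: he|exact: hz].
Qed.

Lemma wspace_lin k r a eta zeta : weight k ->
  wspace k r eta -> wspace k r zeta -> wspace k r (a *: eta + zeta).
Proof.
move=> wk we wz; have := wnorm2_lin a wk ltr01 we wz.
have sm := wspace_sm a we wz.
have [he _ fe] := we; have [hz _ fz] := wz.
move=> le; split; [|exact: sm|].
  by move=> s s0; apply: Hspace_lin; [exact: he|exact: hz].
apply: (le_lt_trans le); apply: lte_add_pinfty.
  by apply: lte_mul_pinfty => //; rewrite lee_fin mulr_ge0 ?sqr_ge0.
by apply: lte_mul_pinfty => //; rewrite lee_fin invr1.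
Qed.

Lemma wspace0 k r : wspace k r 0 /\ wnorm2 k r 0 = 0%E.
Proof.
have [h0 n0] := Hspace0 r.
have w0 : wnorm2 k r 0 = 0%E.
  by apply: integral0_eq => s _; rewrite n0 expr0n mulr0.
split=> //; split => [s _||]; [exact: h0| |by rewrite w0].
have sm0 : strongly_measurable ip (fun=> (0 : R) *: (0 : X)).
  by apply: strongly_measurable_line => //; exact: measurable_cst.
apply: (@strongly_measurable_lin _ _ _ ipP _ _ _ 0 sm0 sm0) => s _.
by rewrite !scaler0 addr0 subr0.
Qed.

Lemma fine_wnorm2_lin k r a eta zeta c : weight k -> 0 < c ->
  wspace k r eta -> wspace k r zeta ->
  fine (wnorm2 k r (a *: eta + zeta)) <=
     (1 + c) * a ^+ 2 * fine (wnorm2 k r eta) +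
     (1 + c^-1) * fine (wnorm2 k r zeta).
Proof.
move=> wk c0 we wz; have := wnorm2_lin a wk c0 we wz.
have fin eta' : wspace k r eta' -> wnorm2 k r eta' \is a fin_num.
  by move=> [_ _ h]; rewrite ge0_fin_numE// wnorm2_ge0.
rewrite -{1}(fineK (fin _ (wspace_lin a wk we wz))) -{1}(fineK (fin _ we)).
by rewrite -{1}(fineK (fin _ wz)) -!EFinM -EFinD lee_fin.
Qed.

End Weighted.

(** * Phase space *)
Section PhaseSpace.
Context {R : realType} {X : lmodType R} (ip : X -> X -> R).
Hypothesis ipP : semi_inner_product ip.
Variables (A : operator (X := X)) (gamma : R^nat).
Hypothesis selfadjA : selfadjoint ip A.
Variables (alpha : R) (mu beta : R -> R).
Hypotheses (wmu : weight mu) (wbeta : weight beta).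

Lemma state_lin (a : R) (u v theta u' v' theta' : X) (eta xi eta' xi' : R -> X) :
  a *: ((u, v, theta, eta, xi) : state) + (u', v', theta', eta', xi') =
  (a *: u + u', a *: v + v', a *: theta + theta', a *: eta + eta', a *: xi + xi').
Proof. by []. Qed.

Local Notation D := (phase_space ip A gamma alpha mu beta).
Local Notation N := (phase_norm ip A gamma alpha mu beta).

Lemma phase_space_lin (a : R) z w : D z -> D w -> D (a *: z + w).
Proof.
case: z w => [[[[u v] th] eta] xi] [[[[u' v'] th'] eta'] xi'].
rewrite state_lin => -[hu he hx] [hu' he' hx']; split.
- exact: Hspace_lin.
- exact: wspace_lin.
- exact: wspace_lin.
Qed.

Lemma phase_space0 : D 0.
Proof.
by split; [exact: (Hspace0 ipP gamma selfadjA 2).1|exact: (wspace0 ipP gamma selfadjA _ _).1..].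
Qed.

Lemma phase_norm0 : N 0 = 0.
Proof.
rewrite /phase_norm/=.
rewrite (Hspace0 ipP gamma selfadjA 2).2 (wspace0 ipP gamma selfadjA mu alpha).2.
by rewrite (wspace0 ipP gamma selfadjA beta 2).2 nrm0// expr0n/= !addr0 sqrtr0.
Qed.

Lemma phase_norm_ge0 z : 0 <= N z.
Proof. by case: z => [[[[u v] th] eta] xi]; exact: sqrtr_ge0. Qed.

Lemma fine_wnorm2_ge0 k r eta : weight k -> 0 <= fine (wnorm2 ip A gamma k r eta).
Proof. by move=> wk; rewrite fine_ge0// wnorm2_ge0. Qed.

Lemma sqr_phase_norm u v theta eta xi :
  N (u, v, theta, eta, xi) ^+ 2 =
  Hnorm ip A gamma 2 u ^+ 2 + nrm ip v ^+ 2 + nrm ip theta ^+ 2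
            + fine (wnorm2 ip A gamma mu alpha eta)
            + fine (wnorm2 ip A gamma beta 2 xi).
Proof. by rewrite sqr_sqrtr// !addr_ge0 ?sqr_ge0 ?fine_wnorm2_ge0. Qed.

Lemma nrm_sqr (a c : R) (u v : X) : 0 < c ->
  nrm ip (a *: u + v) ^+ 2 <=
    (1 + c) * a ^+ 2 * nrm ip u ^+ 2 + (1 + c^-1) * nrm ip v ^+ 2.
Proof.
move=> c0; rewrite -mulrA -[a ^+ 2]real_normK ?num_real// -exprMn -nrmZ//.
by apply: sqr_triangle => //; [exact: nrm_ge0|exact: nrmD].
Qed.

Lemma sum5 (p q x1 x2 x3 x4 x5 y1 y2 y3 y4 y5 z1 z2 z3 z4 z5 : R) :
  x1 <= p * y1 + q * z1 -> x2 <= p * y2 + q * z2 -> x3 <= p * y3 + q * z3 ->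
  x4 <= p * y4 + q * z4 -> x5 <= p * y5 + q * z5 ->
  x1 + x2 + x3 + x4 + x5 <=
    p * (y1 + y2 + y3 + y4 + y5) + q * (z1 + z2 + z3 + z4 + z5).
Proof. by move=> h1 h2 h3 h4 h5; rewrite !mulrDr; lra. Qed.

Lemma eq3_le (p q x y z x' y' z' : R) : x = x' -> y = y' -> z = z' ->
  x' <= p * y' + q * z' -> x <= p * y + q * z.
Proof. by move=> -> -> ->. Qed.

Lemma phase_norm_lin (a : R) z w : D z -> D w ->
  N (a *: z + w) <= `|a| * N z + N w.
Proof.
case: z w => [[[[u v] th] eta] xi] [[[[u' v'] th'] eta'] xi'].
move=> [hu he hx] [hu' he' hx'].
rewrite (state_lin a u v th u' v' th' eta xi eta' xi').
apply: triangle_sqr; [exact: phase_norm_ge0| |exact: phase_norm_ge0|].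
  by rewrite mulr_ge0 ?phase_norm_ge0.
move=> c c0; rewrite exprMn real_normK ?num_real// mulrA.
apply: (eq3_le (sqr_phase_norm _ _ _ _ _) (sqr_phase_norm u v th eta xi)
  (sqr_phase_norm u' v' th' eta' xi')); apply: sum5.
- exact: Hnorm_sqr.
- exact: nrm_sqr.
- exact: nrm_sqr.
- exact: fine_wnorm2_lin.
- exact: fine_wnorm2_lin.
Qed.

End PhaseSpace.

(** * Quasimodes of contraction semigroups *)
Section DifferenceQuotients.
Context {R : realType}.
Implicit Types (f : R -> R) (lambda : R).

Lemma quotient_cvg_right f df : is_derive (0 : R) (1 : R) f df ->
  (f h - f 0) / h @[h --> 0^'+] --> df.
Proof.
move=> [fd <-]; have : cvg (h^-1 *: ((f \o shift 0) (h *: 1) - f 0) @[h --> 0^']).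
  exact: fd.
move=> /cvg_dnbhs_at_right; apply: cvg_trans; apply: near_eq_cvg.
by apply: nearW => h /=; rewrite addr0 [h *: 1]mulr1 mulrC.
Qed.

Lemma is_derive_scaled (g dg : R -> R) lambda (x : R) :
  is_derive (lambda * x) (1 : R) g (dg (lambda * x)) ->
  is_derive x (1 : R) (fun h => g (lambda * h)) (lambda * dg (lambda * x)).
Proof.
move=> gd; have := @is_derive1_comp _ g ( *%R lambda) x _ lambda gd.
rewrite mulrC; apply.
by have := is_deriveM (is_derive_cst lambda x 1) (is_derive_id x 1);
   rewrite !scaler0 addr0 [_ *: 1]mulr1.
Qed.

(** The coefficients of the defect of a rotation in [rotation_defect]. *)
Lemma cvg_trig_right lambda :
  [/\ sin (lambda * h) @[h --> 0^'+] --> (0 : R),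
      sin (lambda * h) / h - lambda * cos (lambda * h) @[h --> 0^'+] --> (0 : R) &
      (cos (lambda * h) - 1) / h + lambda * sin (lambda * h) @[h --> 0^'+] --> (0 : R)].
Proof.
have scont (g : R -> R) : continuous g -> g (lambda * h) @[h --> 0^'+] --> g 0.
  move=> gc; apply: cvg_at_right_filter; rewrite -[X in g X](mulr0 lambda).
  by apply: continuous_comp; [exact: mulrl_continuous|exact: gc].
have s0 : sin (lambda * h) @[h --> 0^'+] --> (0 : R).
  by rewrite -[X in _ --> X]sin0; apply: scont; exact: continuous_sin.
have c0 : cos (lambda * h) @[h --> 0^'+] --> (1 : R).
  by rewrite -[X in _ --> X]cos0; apply: scont; exact: continuous_cos.
have ds := quotient_cvg_right (is_derive_scaled (is_derive_sin (lambda * 0))).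
have dc := quotient_cvg_right (is_derive_scaled
  (dg := fun x => - sin x) (is_derive_cos (lambda * 0))).
split => //.
  rewrite -[X in _ --> X](subrr lambda); apply: cvgB.
    move: ds; rewrite mulr0 sin0 cos0 mulr1.
    by under eq_fun do rewrite subr0.
  by rewrite -[X in _ --> X]mulr1; apply: cvgMr.
rewrite -[X in _ --> X]addr0; apply: cvgD.
  by move: dc; rewrite mulr0 sin0 cos0 oppr0 mulr0.
by rewrite -[X in _ --> X](mulr0 lambda); apply: cvgMr.
Qed.

End DifferenceQuotients.

Section SemigroupLowerBound.
Context {R : realType} {V : lmodType R} (D : set V) (N : V -> R).

(** A seminorm that is controlled only on the carrier [D], as the phase norm is
on the phase space. *)
Definition seminorm_on := [/\ D 0, N 0 = 0, forall z, 0 <= N z,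
  forall a z w, D z -> D w -> D (a *: z + w) &
  forall a z w, D z -> D w -> N (a *: z + w) <= `|a| * N z + N w].

Hypothesis NP : seminorm_on.

Lemma carrierD z w : D z -> D w -> D (z + w).
Proof. by have [_ _ _ h _] := NP; move=> dz dw; have := h 1 _ _ dz dw; rewrite scale1r. Qed.

Lemma carrierZ a z : D z -> D (a *: z).
Proof.
by have [d0 _ _ h _] := NP; move=> dz; have := h a _ _ dz d0; rewrite addr0.
Qed.

Lemma carrierB z w : D z -> D w -> D (z - w).
Proof. by move=> dz dw; rewrite -scaleN1r; apply: carrierD => //; exact: carrierZ. Qed.

Lemma seminormD z w : D z -> D w -> N (z + w) <= N z + N w.
Proof.
have [_ _ _ _ h] := NP; move=> dz dw; have := h 1 _ _ dz dw.
by rewrite scale1r normr1 mul1r.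
Qed.

Lemma seminormZ a z : D z -> N (a *: z) <= `|a| * N z.
Proof.
have [d0 n0 _ _ h] := NP; move=> dz; have := h a _ _ dz d0.
by rewrite n0 !addr0.
Qed.

Lemma seminormB z w : D z -> D w -> N (z - w) <= N z + N w.
Proof.
move=> dz dw; rewrite -scaleN1r (le_trans (seminormD dz (carrierZ _ dw)))//.
by rewrite lerD2l (le_trans (seminormZ _ dw))// normrN1 mul1r.
Qed.

Lemma seminormBC z w : D z -> D w -> N (z - w) = N (w - z).
Proof.
suff H z' w' : D z' -> D w' -> N (z' - w') <= N (w' - z').
  by move=> dz dw; apply/eqP; rewrite eq_le !H.
move=> dz dw; have -> : z' - w' = -1 *: (w' - z') by rewrite scaleN1r opprB.
rewrite (le_trans (seminormZ _ (carrierB dw dz)))//.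
by rewrite normrN1 mul1r.
Qed.

Lemma seminorm_tri y z w : D z -> D w -> D y -> N (z - w) <= N (z - y) + N (y - w).
Proof.
by move=> dz dw dy; rewrite -(subrKA y) seminormD//; exact: carrierB.
Qed.

Let N_ge0 z : 0 <= N z. Proof. by have [] := NP. Qed.

Lemma seminorm_sub z w : D z -> D w -> N z <= N w + N (z - w).
Proof. by move=> dz dw; rewrite -{1}(subrK w z) addrC seminormD//; exact: carrierB. Qed.

Lemma seminorm_null_le z w : D z -> D w -> N (z - w) = 0 -> N z <= N w.
Proof. by move=> dz dw zw; rewrite (le_trans (seminorm_sub dz dw))// zw addr0. Qed.

Lemma seminorm_null_trans y z w : D z -> D w -> D y ->
  N (z - y) = 0 -> N (y - w) = 0 -> N (z - w) = 0.
Proof.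
move=> dz dw dy zy yw; apply/eqP; rewrite eq_le N_ge0 andbT.
by rewrite (le_trans (seminorm_tri dz dw dy))// zy yw addr0.
Qed.

Lemma seminorm_null_lin a z w z' w' : D z -> D w -> D z' -> D w' ->
  N (z - z') = 0 -> N (w - w') = 0 -> N (a *: z + w - (a *: z' + w')) = 0.
Proof.
have [_ _ _ _ h] := NP; move=> dz dw dz' dw' zz ww.
apply/eqP; rewrite eq_le N_ge0 andbT opprD addrACA -scalerBr.
by rewrite (le_trans (h _ _ _ (carrierB dz dz') (carrierB dw dw')))// zz ww mulr0 addr0.
Qed.

Variable S : R -> V -> V.
Hypothesis SP : contraction_semigroup D N S.

Let SD t z : 0 <= t -> D z -> D (S t z).
Proof. by have [h _ _ _ _] := SP => t0 dz; have [] := h t z t0 dz. Qed.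

Let SN t z : 0 <= t -> D z -> N (S t z) <= N z.
Proof. by have [h _ _ _ _] := SP => t0 dz; have [] := h t z t0 dz. Qed.

Lemma semigroup_comb t c s z w : 0 <= t -> D z -> D w ->
  N (S t (c *: z + s *: w) - (c *: S t z + s *: S t w)) = 0.
Proof.
have [d0 n0 _ Dl Nl] := NP; have [_ lin _ _ _] := SP; move=> t0 dz dw.
have dsw := carrierZ s dw.
have S0 : N (S t 0) = 0 by apply/eqP; rewrite eq_le N_ge0 andbT -[leRHS]n0 SN.
have l1 := lin t c z (s *: w) t0 dz dsw.
have l2 := lin t s w 0 t0 dw d0.
rewrite addr0 in l2.
have h2 : N (S t (s *: w) - s *: S t w) = 0.
  apply: (seminorm_null_trans _ _ _ l2).
  - by apply: SD.
  - by apply: carrierZ; exact: SD.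
  - by apply: carrierD; [apply: carrierZ; exact: SD|exact: SD].
  - by rewrite addrC addKr.
apply: (seminorm_null_trans _ _ _ l1).
- by apply: SD => //; apply: Dl.
- by apply: Dl; [exact: SD|apply: carrierZ; exact: SD].
- by apply: Dl; exact: SD.
apply: seminorm_null_lin; rewrite ?subrr//; try exact: SD.
by apply: carrierZ; exact: SD.
Qed.

Lemma carrier_comb c s z w : D z -> D w -> D (c *: z + s *: w).
Proof. by move=> dz dw; apply: carrierD; exact: carrierZ. Qed.

Lemma seminorm_null_comb c s z w z' w' : D z -> D w -> D z' -> D w' ->
  N (z - z') = 0 -> N (w - w') = 0 ->
  N (c *: z + s *: w - (c *: z' + s *: w')) = 0.
Proof.
move=> dz dw dz' dw' zz ww; apply: seminorm_null_lin => //; try exact: carrierZ.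
have [d0 _ _ _ _] := NP.
have := seminorm_null_lin s dw d0 dw' d0 ww; rewrite !addr0; apply.
by rewrite subrr; have [] := NP.
Qed.

Lemma seminorm_comb_le c s z w : `|c| <= 1 -> `|s| <= 1 -> D z -> D w ->
  N (c *: z + s *: w) <= N z + N w.
Proof.
move=> c1 s1 dz dw; apply: (le_trans (seminormD (carrierZ _ dz) (carrierZ _ dw))).
by apply: lerD; [move: dz|move: dw] => d; apply: (le_trans (seminormZ _ d));
   rewrite ler_piMl.
Qed.

Lemma cos_norm_le1 x : `|cos x : R| <= 1.
Proof. by rewrite ler_norml cos_geN1 cos_le1. Qed.

Lemma sin_norm_le1 x : `|sin x : R| <= 1.
Proof. by rewrite ler_norml sin_geN1 sin_le1. Qed.

(** The pair [(x, y)] stands for the real and imaginary parts of a complex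
vector: rotating it by [th] and then reading it along [psi] amounts to reading
it along [psi + th]. *)
Lemma rotation (psi th : R) (x y p q : V) :
  cos psi *: (cos th *: x + sin th *: y - p) +
  sin psi *: (cos th *: y - sin th *: x - q) =
  cos (psi + th) *: x + sin (psi + th) *: y - (cos psi *: p + sin psi *: q).
Proof.
rewrite !scalerBr addrACA -opprD; congr (_ - _).
rewrite cosD sinD scalerDr !scalerA scalerBl scalerDl.
by rewrite [X in _ + X = _]addrC addrACA; congr (_ + _); rewrite addrC.
Qed.

(** Rotating by [lambda h] undoes the evolution during [h], up to the defect
measured by the last two norms; contractivity keeps that defect from growing
during the time [t] already elapsed. *)
Lemma semigroup_step lambda h a b t psi : 0 <= h -> 0 <= t -> D a -> D b ->
  N (cos psi *: S t a + sin psi *: S t b) <=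
    N (cos (psi + lambda * h) *: S (t + h) a
       + sin (psi + lambda * h) *: S (t + h) b)
    + (N (cos (lambda * h) *: S h a + sin (lambda * h) *: S h b - a)
       + N (cos (lambda * h) *: S h b - sin (lambda * h) *: S h a - b)).
Proof.
move=> h0 t0 da db.
have [dx dy] : D (S h a) /\ D (S h b) by split; exact: SD.
set x := S h a in dx *; set y := S h b in dy *; set th := lambda * h.
set P := cos th *: x + sin th *: y - a; set Q := cos th *: y - sin th *: x - b.
have dP : D P by apply: carrierB => //; exact: carrier_comb.
have dQ : D Q by apply: carrierB => //; apply: carrierB; exact: carrierZ.
have E : cos psi *: a + sin psi *: b =
    (1 : R) *: (cos (psi + th) *: x + sin (psi + th) *: y)
    + (-1 : R) *: (cos psi *: P + sin psi *: Q).
  by rewrite scale1r scaleN1r rotation opprB [RHS]addrC subrK.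
have dX := carrier_comb (cos (psi + th)) (sin (psi + th)) dx dy.
have dY := carrier_comb (cos psi) (sin psi) dP dQ.
have dXY := carrier_comb 1 (-1) dX dY.
have dab := carrier_comb (cos psi) (sin psi) da db.
have dSab := carrier_comb (cos psi) (sin psi) (SD t0 da) (SD t0 db).
apply: (@le_trans _ _ (N (S t (cos psi *: a + sin psi *: b)))).
  apply: seminorm_null_le => //; first exact: SD.
  by rewrite seminormBC//; [exact: semigroup_comb|exact: SD].
rewrite E.
have dSXY := carrier_comb 1 (-1) (SD t0 dX) (SD t0 dY).
apply: (le_trans (seminorm_null_le (SD t0 dXY) dSXY (semigroup_comb _ _ t0 dX dY))).
rewrite scale1r scaleN1r; apply: (le_trans (seminormB (SD t0 dX) (SD t0 dY))).
apply: lerD; last first.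
  apply: (le_trans (SN t0 dY)).
  by apply: seminorm_comb_le => //; [exact: cos_norm_le1|exact: sin_norm_le1].
have dSh := carrier_comb (cos (psi + th)) (sin (psi + th)) (SD t0 dx) (SD t0 dy).
have th0 : 0 <= t + h by rewrite addr_ge0.
have dSth := carrier_comb (cos (psi + th)) (sin (psi + th)) (SD th0 da) (SD th0 db).
apply: seminorm_null_le => //; first exact: SD.
apply: (seminorm_null_trans _ _ _ (semigroup_comb _ _ t0 dx dy)) => //; first exact: SD.
have [_ _ _ SS _] := SP.
apply: seminorm_null_comb; try exact: SD.
  by rewrite seminormBC ?SS//; exact: SD.
by rewrite seminormBC ?SS//; exact: SD.
Qed.

(** The reading along [phi] is compared at the times [0], [h], ..., [n h], each
step turning [phi] by [lambda h]. *)
Lemma semigroup_iter lambda h a b E : 0 <= h -> D a -> D b ->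
  N (cos (lambda * h) *: S h a + sin (lambda * h) *: S h b - a) +
  N (cos (lambda * h) *: S h b - sin (lambda * h) *: S h a - b) <= E ->
  forall n phi, N (cos phi *: a + sin phi *: b) <=
    N (S (n%:R * h) a) + N (S (n%:R * h) b) + n%:R * E.
Proof.
move=> h0 da db PQE n phi.
have [_ _ S0 _ _] := SP.
have nh0 m : 0 <= m%:R * h by rewrite mulr_ge0.
suff : N (cos phi *: a + sin phi *: b) <=
    N (cos (phi + n%:R * (lambda * h)) *: S (n%:R * h) a
       + sin (phi + n%:R * (lambda * h)) *: S (n%:R * h) b) + n%:R * E.
  move=> /le_trans; apply; rewrite lerD2r.
  by apply: seminorm_comb_le; [exact: cos_norm_le1|exact: sin_norm_le1|exact: SD..].
elim: n => [|n IH].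
  have dSa := SD (lexx 0) da; have dSb := SD (lexx 0) db.
  rewrite !mul0r !addr0.
  apply: (seminorm_null_le (carrier_comb _ _ da db) (carrier_comb _ _ dSa dSb)).
  apply: (seminorm_null_comb _ _ da db dSa dSb).
    by rewrite (seminormBC da dSa); exact: S0.
  by rewrite (seminormBC db dSb); exact: S0.
apply: (le_trans IH).
have := semigroup_step lambda (phi + n%:R * (lambda * h)) h0 (nh0 n) da db.
have -> : phi + n%:R * (lambda * h) + lambda * h = phi + n.+1%:R * (lambda * h).
  by rewrite -natr1; ring.
have -> : n%:R * h + h = n.+1%:R * h by rewrite -natr1; ring.
have -> : n.+1%:R * E = n%:R * E + E by rewrite -natr1; ring.
move=> st; lra.
Qed.

End SemigroupLowerBound.

(** Vector identities between combinations of six vectors reduce to scalar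
identities between their coefficients. *)
Section SixVectors.
Context {R : realType} {V : lmodType R} (D : set V) (N : V -> R).
Hypothesis NP : seminorm_on D N.
Variables v1 v2 v3 v4 v5 v6 : V.

Definition comb6 (c1 c2 c3 c4 c5 c6 : R) : V :=
  c1 *: v1 + c2 *: v2 + c3 *: v3 + c4 *: v4 + c5 *: v5 + c6 *: v6.

Lemma comb6_lin k c1 c2 c3 c4 c5 c6 d1 d2 d3 d4 d5 d6 :
  k *: comb6 c1 c2 c3 c4 c5 c6 + comb6 d1 d2 d3 d4 d5 d6 =
  comb6 (k * c1 + d1) (k * c2 + d2) (k * c3 + d3) (k * c4 + d4)
        (k * c5 + d5) (k * c6 + d6).
Proof.
rewrite /comb6 !scalerDr !scalerA !scalerDl.
by do 5 (rewrite addrACA; congr (_ + _)).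
Qed.

Lemma seminorm_comb6 c1 c2 c3 c4 c5 c6 :
  D v1 -> D v2 -> D v3 -> D v4 -> D v5 -> D v6 ->
  N (comb6 c1 c2 c3 c4 c5 c6) <= `|c1| * N v1 + `|c2| * N v2 + `|c3| * N v3
    + `|c4| * N v4 + `|c5| * N v5 + `|c6| * N v6.
Proof.
move=> d1 d2 d3 d4 d5 d6.
have Z c v : D v -> D (c *: v) by exact: (carrierZ NP).
have P z w x c : D z -> D w -> N z <= x -> D (z + c *: w) /\ N (z + c *: w) <= x + `|c| * N w.
  move=> dz dw zx; split; first by apply: (carrierD NP) => //; exact: Z.
  apply: (le_trans (seminormD NP dz (Z c w dw))); apply: lerD => //.
  exact: (seminormZ NP).
have q1 : N (c1 *: v1) <= `|c1| * N v1 by exact: (seminormZ NP).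
have [e2 q2] := P _ _ _ c2 (Z c1 _ d1) d2 q1.
have [e3 q3] := P _ _ _ c3 e2 d3 q2.
have [e4 q4] := P _ _ _ c4 e3 d4 q3.
have [e5 q5] := P _ _ _ c5 e4 d5 q4.
by have [] := P _ _ _ c6 e5 d6 q5.
Qed.

End SixVectors.

Section QuasiMode.
Context {R : realType} {V : lmodType R} (D : set V) (N : V -> R).
Hypothesis NP : seminorm_on D N.
Variable S : R -> V -> V.
Hypothesis SP : contraction_semigroup D N S.

(** Defect of the rotation after one step of length [h], for a pair with
[L a = r1 - lambda b] and [L b = lambda a + r2]; [da] and [db] are the errors of
the difference quotients. *)
Lemma rotation_defect lambda a b r1 r2 da db (h : R) :
  S h a = a + h *: (da + (r1 - lambda *: b)) ->
  S h b = b + h *: (db + (lambda *: a + r2)) ->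
  0 < h -> D a -> D b -> D r1 -> D r2 -> D da -> D db ->
  N (cos (lambda * h) *: S h a + sin (lambda * h) *: S h b - a) +
  N (cos (lambda * h) *: S h b - sin (lambda * h) *: S h a - b) <=
  h * ((`|(cos (lambda * h) - 1) / h + lambda * sin (lambda * h)| +
        `|sin (lambda * h) / h - lambda * cos (lambda * h)|) * (N a + N b) +
       (1 + `|sin (lambda * h)|) * (N r1 + N r2) + 2 * (N da + N db)).
Proof.
move=> ShaE ShbE h0 Da Db D1 D2 Dda Ddb.
have hn0 : h != 0 by rewrite gt_eqF.
pose F := comb6 a b r1 r2 da db.
have Sha : S h a = F 1 (- (lambda * h)) h 0 h 0.
  rewrite ShaE /F /comb6 scale1r !scale0r !addr0 !scalerDr scalerN scalerA scaleNr.
  rewrite (mulrC lambda) -!addrA; congr (_ + _).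
  by rewrite addrA [LHS]addrC; congr (_ + _); exact: addrC.
have Shb : S h b = F (lambda * h) 1 0 h 0 h.
  rewrite ShbE /F /comb6 scale1r !scale0r !addr0 !scalerDr scalerA (mulrC lambda).
  rewrite -!addrA [RHS]addrCA; congr (_ + _); rewrite [LHS]addrCA.
  by congr (_ + _); exact: addrC.
have aF : a = F 1 0 0 0 0 0 by rewrite /F /comb6 !scale0r !addr0 scale1r.
have bF : b = F 0 1 0 0 0 0 by rewrite /F /comb6 !scale0r !addr0 add0r scale1r.
have F0 : 0 = F 0 0 0 0 0 0 by rewrite /F /comb6 !scale0r !addr0.
set c := cos _; set s := sin _.
have c1 : `|c| <= 1 by exact: cos_norm_le1.
have PE : c *: S h a + s *: S h b - a =
  h *: F ((c - 1) / h + lambda * s) (s / h - lambda * c) c s c s.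
  have -> : - a = -1 *: F 1 0 0 0 0 0 by rewrite -aF scaleN1r.
  rewrite -[LHS]addr0 -[RHS]addr0 -!addrA Sha Shb F0.
  by rewrite !comb6_lin; congr F; field.
have QE : c *: S h b - s *: S h a - b =
  h *: F (- (s / h - lambda * c)) ((c - 1) / h + lambda * s) (- s) c (- s) c.
  have -> : - b = -1 *: F 0 1 0 0 0 0 by rewrite -bF scaleN1r.
  rewrite -[LHS]addr0 -[RHS]addr0 -scaleNr -!addrA Sha Shb F0.
  by rewrite !comb6_lin; congr F; field.
have DF x1 x2 x3 x4 x5 x6 : D (F x1 x2 x3 x4 x5 x6).
  by do 5 (apply: (carrierD NP); last exact: (carrierZ NP)); exact: (carrierZ NP).
have hh v : D v -> N (h *: v) <= h * N v.
  by move=> Dv; have := seminormZ NP h Dv; rewrite gtr0_norm.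
rewrite PE QE; apply: (le_trans (lerD (hh _ (DF _ _ _ _ _ _)) (hh _ (DF _ _ _ _ _ _)))).
rewrite -mulrDr ler_wpM2l ?(ltW h0)//.
have b1 := seminorm_comb6 NP ((c - 1) / h + lambda * s) (s / h - lambda * c) c s c s
  Da Db D1 D2 Dda Ddb.
have b2 := seminorm_comb6 NP (- (s / h - lambda * c)) ((c - 1) / h + lambda * s)
  (- s) c (- s) c Da Db D1 D2 Dda Ddb.
apply: (le_trans (lerD b1 b2)); rewrite !normrN.
have s1 : `|s| <= 1 by exact: sin_norm_le1.
move: c1 s1.
have [_ _ N0 _ _] := NP.
have n1 := N0 r1; have n2 := N0 r2; have n3 := N0 da; have n4 := N0 db.
move: `|c| `|s| `| _ / h + _ | `| _ / h - _ | => k1 k2 x y c1 s1.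
have e (k u : R) : 0 <= u -> k <= 1 -> k * u <= u.
  by move=> u0 kle1; rewrite ler_piMl.
have := e _ _ n1 c1; have := e _ _ n2 c1; have := e _ _ n3 c1; have := e _ _ n4 c1.
have := e _ _ n3 s1; have := e _ _ n4 s1.
lra.
Qed.

(** A contraction semigroup cannot damp an oscillating pair faster than the
residuals [r1], [r2] allow: by [semigroup_iter] with [n] steps of length [T / n],
the loss is [T] times the rate of [rotation_defect], whose limit as [n] grows
is [N r1 + N r2]. *)
Theorem quasimode_lower_bound lambda a b r1 r2 T : 0 < T ->
  generator D N S a (r1 - lambda *: b) -> generator D N S b (lambda *: a + r2) ->
  D r1 -> D r2 ->
  N a + N b <= 2 * (N (S T a) + N (S T b)) + 2 * T * (N r1 + N r2).
Proof.
move=> T0 [Da _ ga] [Db _ gb] D1 D2.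
have [t1 t2 t3] := cvg_trig_right lambda.
pose G h := (`|(cos (lambda * h) - 1) / h + lambda * sin (lambda * h)| +
        `|sin (lambda * h) / h - lambda * cos (lambda * h)|) * (N a + N b) +
       (1 + `|sin (lambda * h)|) * (N r1 + N r2) +
       2 * (N (h^-1 *: (S h a - a) - (r1 - lambda *: b)) +
            N (h^-1 *: (S h b - b) - (lambda *: a + r2))).
have Gcvg : G h @[h --> 0^'+] --> N r1 + N r2.
  have -> : N r1 + N r2 = (`|0 : R| + `|0 : R|) * (N a + N b) + (1 + `|0 : R|) * (N r1 + N r2)
       + 2 * (0 + 0) by rewrite normr0; ring.
  apply: cvgD; last by apply: cvgMr; exact: cvgD.
  apply: cvgD; apply: cvgMl; apply: cvgD; try exact: cvg_norm.
  exact: cvg_cst.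
apply/ler_addgt0Pr => e e0.
pose d := e / (2 * T); have d0 : 0 < d by rewrite divr_gt0// mulr_gt0.
have /nbhs_ballP[r /= r0 Hr] : \forall h \near 0^'+, G h <= N r1 + N r2 + d.
  by apply: cvgr_le Gcvg _ _; rewrite ltrDl.
pose n := (Num.truncn (T / r)).+1.
have n0 : (0 : R) < n%:R by rewrite ltr0n.
have hT : n%:R * (T / n%:R) = T by rewrite mulrC divfK// gt_eqF.
have h0 : 0 < T / n%:R by rewrite divr_gt0.
have hr : T / n%:R < r.
  by rewrite ltr_pdivrMr// mulrC -ltr_pdivrMr// truncnS_gt.
have Gh : G (T / n%:R) <= N r1 + N r2 + d.
  by apply: Hr => //=; rewrite /ball/= sub0r normrN gtr0_norm.
have hE (z w : V) : S (T / n%:R) z =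
    z + (T / n%:R) *: ((T / n%:R)^-1 *: (S (T / n%:R) z - z) - w + w).
  by rewrite subrK scalerA divff ?gt_eqF// scale1r addrC subrK.
have Dh z w : D z -> D w -> D ((T / n%:R)^-1 *: (S (T / n%:R) z - z) - w).
  move=> Dz Dw; apply: (carrierB NP) => //; apply: (carrierZ NP); apply: (carrierB NP) => //.
  by have [SD _ _ _ _] := SP; have [] := SD _ z (ltW h0) Dz.
have Dw1 : D (r1 - lambda *: b) by apply: (carrierB NP) => //; exact: (carrierZ NP).
have Dw2 : D (lambda *: a + r2) by apply: (carrierD NP) => //; exact: (carrierZ NP).
have bd := rotation_defect (hE _ _) (hE _ _) h0 Da Db D1 D2 (Dh _ _ Da Dw1)
  (Dh _ _ Db Dw2).
have it := semigroup_iter NP SP (ltW h0) Da Db bd n.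
rewrite hT in it.
(* The pair is read along the angle [0] for [a] and [pi / 2] for [b]. *)
have := it 0; rewrite cos0 sin0 scale1r scale0r addr0 => ia.
have := it (pi / 2); rewrite cos_pihalf sin_pihalf scale1r scale0r add0r => ib.
rewrite mulrA hT in ia ib.
have {}ia : N a <= N (S T a) + N (S T b) + T * G (T / n%:R) := ia.
have {}ib : N b <= N (S T a) + N (S T b) + T * G (T / n%:R) := ib.
have TG : T * G (T / n%:R) <= T * (N r1 + N r2) + e / 2.
  have -> : T * (N r1 + N r2) + e / 2 = T * (N r1 + N r2 + d).
    by rewrite /d; field; rewrite gt_eqF.
  by rewrite ler_wpM2l// ltW.
move: ia ib TG; move: (G _) => g; lra.
Qed.

End QuasiMode.

(** * The memory kernel *)
Section Kernel.
Context {R : realType}.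
Implicit Types (f phi Phi g G : R -> R) (a b s lambda : R).
Local Notation Rplus := (`]0%R, +oo[%classic : set R).
Local Notation leb := (@lebesgue_measure R).

Lemma is_derive_continuous f (x df : R) : is_derive x (1 : R) f df -> {for x, continuous f}.
Proof.
move=> [fd _]; apply: differentiable_continuous; exact/derivable1_diffP.
Qed.

Lemma continuous_pos_within f a b : 0 < a ->
  (forall x : R, 0 < x -> {for x, continuous f}) -> {within `[a, b], continuous f}.
Proof.
move=> a0 cf; apply: continuous_in_subspaceT => x.
rewrite inE/= in_itv/= => /andP[ax _]; apply: cf; exact: lt_le_trans ax.
Qed.

Lemma continuous_pos_integrable f a b : 0 < a ->
  (forall x : R, 0 < x -> {for x, continuous f}) -> leb.-integrable `[a, b] (EFin \o f).
Proof.
move=> a0 cf; apply: continuous_compact_integrable; first exact: segment_compact.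
exact: continuous_pos_within.
Qed.

(** All the integral bounds below come from primitives: an integrand dominated by
a derivative is integrated without being computed. *)
Lemma Rintegral_le_primitive f phi Phi a b : 0 < a -> a < b ->
  (forall x : R, 0 < x -> {for x, continuous f}) ->
  (forall x : R, 0 < x -> {for x, continuous phi}) ->
  (forall x : R, 0 < x -> is_derive x (1 : R) Phi (phi x)) ->
  (forall x, a <= x <= b -> f x <= phi x) ->
  \int[leb]_(x in `[a, b]) f x <= Phi b - Phi a.
Proof.
move=> a0 ab cf cphi dPhi fphi.
have b0 : 0 < b by exact: lt_trans ab.
have E : (\int[leb]_(x in `[a, b]) (phi x)%:E = (Phi b)%:E - (Phi a)%:E)%E.
  apply: continuous_FTC2 => //; first exact: continuous_pos_within.
    split.
    - move=> x; rewrite in_itv/= => /andP[ax _].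
      by have [] := dPhi x (lt_trans a0 ax).
    - by apply: cvg_at_right_filter; apply: is_derive_continuous; exact: dPhi.
    - by apply: cvg_at_left_filter; apply: is_derive_continuous; exact: dPhi.
  move=> x; rewrite in_itv/= => /andP[ax _]; rewrite derive1E.
  by have [_ ->] := dPhi x (lt_trans a0 ax).
apply: (@le_trans _ _ (\int[leb]_(x in `[a, b]) phi x)); last by rewrite /Rintegral E.
by apply: le_Rintegral => //; exact: continuous_pos_integrable.
Qed.

(** The kernel may be singular at [0] and its domain unbounded, so that integrals are
bounded on compact intervals first. *)
Lemma exhaustion f B : measurable_fun Rplus f -> (forall s, 0 < s -> 0 <= f s) ->
  (\forall n \near \oo, (\int[leb]_(x in `[(n.+1%:R^-1)%R, (n.+1%:R)%R]) (f x)%:E <= B)%E) ->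
  (\int[leb]_(x in Rplus) (f x)%:E <= B)%E.
Proof.
move=> mf f0 HB.
pose F n := [set` `[n.+1%:R^-1, n.+1%:R : R]] : set R.
have FU : Rplus = \bigcup_n F n.
  apply/seteqP; split => x; rewrite /= in_itv/= andbT; [move=> x0|move=> [n _]].
    exists (Num.truncn (Num.max x x^-1)) => //; rewrite /F/= in_itv/=.
    have := truncnS_gt (Num.max x x^-1); rewrite gt_max => /andP[xn xVn].
    by rewrite (ltW xn) andbT invf_ple// ?posrE// ltW.
  by rewrite /F/= in_itv/= => /andP[+ _]; apply: lt_le_trans; rewrite invr_gt0.
have FR n : F n `<=` Rplus by rewrite FU; exact: bigcup_sup.
have nF : nondecreasing_seq F.
  move=> m n mn; apply/subsetPset => x; rewrite /F/= !in_itv/= => /andP[mx xm].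
  rewrite (le_trans _ mx) ?(le_trans xm) ?ler_nat// lef_pV2 ?posrE// ler_nat//.
have mF n : measurable (F n) by exact: measurable_itv.
have mfF n : measurable_fun (F n) (EFin \o f).
  apply/measurable_EFinP; apply: measurable_funS mf => //.
have f0F n x : F n x -> (0 <= (EFin \o f) x)%E.
  by move=> /FR; rewrite /= in_itv/= andbT lee_fin; exact: f0.
have h := ge0_nondecreasing_set_cvg_integral (mu := leb) nF mF mfF f0F.
rewrite FU -(cvg_lim _ h)//; apply: lime_le => //.
by apply/cvg_ex; eexists; exact: h.
Qed.

Variables (kappa omega delta : R).
Hypotheses (kappa0 : 0 < kappa) (omega0 : 0 <= omega) (omega1 : omega < 1)
  (delta0 : 0 < delta).

Definition kernel s := kappa * s `^ (- omega) * expR (- delta * s).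
Definition kernel_prime s := kappa * (- omega * s `^ (- omega - 1)) * expR (- delta * s)
  - delta * kernel s.

Lemma is_derive_expR_scaled c (s : R) :
  is_derive s (1 : R) (fun s => expR (c * s)) (c * expR (c * s)).
Proof. exact: (is_derive_scaled (is_derive_expR (c * s))). Qed.

Lemma is_derive_kernel s : 0 < s -> is_derive s (1 : R) kernel (kernel_prime s).
Proof.
move=> s0.
have H := is_deriveM (is_deriveZ kappa (is_derive1_powR (- omega) s0))
  (is_derive_expR_scaled (- delta) s).
apply: (is_derive_eq H); rewrite /kernel_prime /kernel /GRing.scale/=.
by rewrite -[kappa *: _]/(kappa * _); ring.
Qed.

Lemma kernel_ge0 s : 0 <= kernel s.
Proof. by rewrite /kernel !mulr_ge0 ?powR_ge0 ?expR_ge0 ?ltW. Qed.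

Lemma continuous_kernel (s : R) : 0 < s -> {for s, continuous kernel}.
Proof. by move=> s0; apply: is_derive_continuous; exact: is_derive_kernel. Qed.

Lemma continuous_kernel_prime (s : R) : 0 < s -> {for s, continuous kernel_prime}.
Proof.
move=> s0; apply: continuousB; apply: continuousM; try exact: cvg_cst.
- apply: continuousM; first exact: cvg_cst.
  apply: continuousM; first exact: cvg_cst.
  by apply: is_derive_continuous; exact: is_derive1_powR.
- by apply: is_derive_continuous; exact: is_derive_expR_scaled.
- exact: continuous_kernel.
Qed.

Lemma kernel_prime_le0 s : kernel_prime s <= 0.
Proof.
rewrite /kernel_prime subr_le0 (@le_trans _ _ 0)//; last first.
  by rewrite mulr_ge0 ?kernel_ge0 ?ltW.
by rewrite mulNr mulrN mulNr oppr_le0 !mulr_ge0 ?powR_ge0 ?expR_ge0// ltW.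
Qed.

Lemma measurable_kernel : measurable_fun setT kernel.
Proof.
apply: measurable_funM.
  apply: measurable_funM; first exact: measurable_cst.
  exact: (@measurable_powR R (- omega)).
by apply: measurableT_comp => //; exact: measurable_funM.
Qed.

(** From [1 - e^(- delta s) <= delta s], the derivative of this bounded increasing
function dominates the kernel; the function itself is of order
[s^(1 - omega)] at [0]. *)
Definition majorant_primitive s := kappa * delta `^ (omega - 1) / (1 - omega) *
  (1 - expR (- delta * s)) `^ (1 - omega).

Definition kernel_majorant s := kappa * delta `^ omega *
  (1 - expR (- delta * s)) `^ (- omega) * expR (- delta * s).

Lemma one_minus_expR_gt0 s : 0 < s -> 0 < 1 - expR (- delta * s).
Proof.
by move=> s0; rewrite subr_gt0 -[ltRHS]expR0 ltr_expR mulNr oppr_lt0 mulr_gt0.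
Qed.

Lemma is_derive_majorant_primitive s : 0 < s ->
  is_derive s (1 : R) majorant_primitive (kernel_majorant s).
Proof.
move=> s0.
have d1 := is_deriveB (is_derive_cst (1 : R) s 1) (is_derive_expR_scaled (- delta) s).
have d2 := is_derive1_powR (1 - omega) (one_minus_expR_gt0 s0).
have d3 := @is_derive1_comp _ (@powR R ^~ (1 - omega))
  (fun s => 1 - expR (- delta * s)) s _ _ d2 d1.
have H := is_deriveZ (kappa * delta `^ (omega - 1) / (1 - omega)) d3.
apply: (is_derive_eq H); rewrite /kernel_majorant /GRing.scale/=.
have -> : delta `^ omega = delta `^ (omega - 1) * delta.
  rewrite -{3}[delta]powRr1 ?(ltW delta0)// -powRD ?subrK//.
  by apply/implyP => _; rewrite gt_eqF.
have -> : 1 - omega - 1 = - omega by ring.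
by field; rewrite subr_eq0 gt_eqF.
Qed.

Lemma kernel_le_majorant s : 0 < s -> kernel s <= kernel_majorant s.
Proof.
move=> s0; have e0 := one_minus_expR_gt0 s0.
have es : 1 - expR (- delta * s) <= delta * s.
  by have := expR_ge1Dx (- delta * s); lra.
rewrite /kernel /kernel_majorant ler_wpM2r ?expR_ge0// -mulrA.
rewrite ler_wpM2l ?(ltW kappa0)// !powRN.
rewrite ler_pdivlMr ?powR_gt0// ler_pdivrMl ?powR_gt0//.
rewrite -powRM ?(ltW delta0) ?(ltW s0)// (mulrC s).
by apply: ge0_ler_powR => //; rewrite nnegrE ?(ltW e0)// mulr_ge0 ?ltW.
Qed.

Lemma majorant_primitive_ge0 s : 0 <= majorant_primitive s.
Proof.
by rewrite /majorant_primitive !mulr_ge0 ?powR_ge0 ?invr_ge0 ?subr_ge0 ?ltW.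
Qed.

Lemma majorant_primitive_le s : 0 < s ->
  majorant_primitive s <= kappa * delta `^ (omega - 1) / (1 - omega).
Proof.
move=> s0; rewrite /majorant_primitive ler_piMr//.
  by rewrite !mulr_ge0 ?powR_ge0 ?invr_ge0 ?subr_ge0 ?ltW.
apply: (@le_trans _ _ (1 `^ (1 - omega))); last by rewrite powR1.
apply: ge0_ler_powR.
- by rewrite subr_ge0 ltW.
- by rewrite nnegrE ltW// one_minus_expR_gt0.
- by rewrite nnegrE.
- by rewrite gerBl expR_ge0.
Qed.

Lemma majorant_primitive_le_near0 s : 0 < s ->
  majorant_primitive s <= kappa / (1 - omega) * s `^ (1 - omega).
Proof.
move=> s0; have e0 := one_minus_expR_gt0 s0.
have es : 1 - expR (- delta * s) <= delta * s.
  by have := expR_ge1Dx (- delta * s); lra.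
have h : (1 - expR (- delta * s)) `^ (1 - omega) <=
         delta `^ (1 - omega) * s `^ (1 - omega).
  rewrite -powRM ?(ltW delta0) ?(ltW s0)//; apply: ge0_ler_powR => //.
  - by rewrite subr_ge0 ltW.
  - by rewrite nnegrE ltW.
  - by rewrite nnegrE mulr_ge0 ?ltW.
have c0 : 0 <= kappa * delta `^ (omega - 1) / (1 - omega).
  by rewrite !mulr_ge0 ?powR_ge0 ?invr_ge0 ?subr_ge0 ?ltW.
apply: (le_trans (ler_wpM2l c0 h)); rewrite le_eqVlt; apply/orP; left; apply/eqP.
have -> : omega - 1 = - (1 - omega) by ring.
rewrite powRN; have := powR_gt0 (1 - omega) delta0.
move: (delta `^ _) => d d0; field.
by rewrite subr_eq0 !gt_eqF.
Qed.

Lemma integral_kernel_itv a b : 0 < a -> a < b ->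
  \int[leb]_(x in `[a, b]) kernel x <= majorant_primitive b - majorant_primitive a.
Proof.
move=> a0 ab; apply: (@Rintegral_le_primitive _ kernel_majorant _ _ _ a0 ab).
- by move=> x x0; apply: continuous_kernel.
- move=> x x0.
  have d1 := is_deriveB (is_derive_cst (1 : R) x 1) (is_derive_expR_scaled (- delta) x).
  have d3 := @is_derive1_comp _ (@powR R ^~ (- omega))
    (fun s => 1 - expR (- delta * s)) x _ _ (is_derive1_powR (- omega) (one_minus_expR_gt0 x0)) d1.
  have d4 := is_deriveM (is_deriveZ (kappa * delta `^ omega) d3)
     (is_derive_expR_scaled (- delta) x).
  exact: (is_derive_continuous d4).
- by move=> x; exact: is_derive_majorant_primitive.
- by move=> x /andP[ax _]; apply: kernel_le_majorant; exact: lt_le_trans ax.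
Qed.

Lemma integral_EFin_itv f a b : 0 < a ->
  (forall x : R, 0 < x -> {for x, continuous f}) ->
  (\int[leb]_(x in `[a, b]) (f x)%:E)%E = (\int[leb]_(x in `[a, b]) f x)%:E.
Proof.
move=> a0 cf; rewrite /Rintegral fineK//; apply: integrable_fin_num => //.
exact: continuous_pos_integrable.
Qed.

Lemma integrable_kernel : leb.-integrable Rplus (EFin \o kernel).
Proof.
apply/integrableP; split.
  by apply/measurable_EFinP; apply: measurable_funTS; exact: measurable_kernel.
apply: (@le_lt_trans _ _ (\int[leb]_(x in Rplus) (kernel x)%:E)%E).
  rewrite le_eqVlt; apply/orP; left; apply/eqP; apply: eq_integral => x _.
  by rewrite /= ger0_norm// kernel_ge0.
apply: (@le_lt_trans _ _ (kappa * delta `^ (omega - 1) / (1 - omega))%:E);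
  last exact: ltry.
apply: exhaustion.
- by apply: measurable_funTS; exact: measurable_kernel.
- by move=> s _; exact: kernel_ge0.
exists 1%N => // n /= n1.
have n0 : (0 : R) < n.+1%:R^-1 by rewrite invr_gt0.
rewrite integral_EFin_itv//; last by move=> x x0; exact: continuous_kernel.
have nn : n.+1%:R^-1 < n.+1%:R :> R.
  rewrite invf_plt ?posrE// -[X in _ < X]mulr1.
  by rewrite (lt_trans _ (_ : 1 < _)) ?invf_lt1 ?ltr1n// mulr1 ltr1n.
rewrite lee_fin (le_trans (integral_kernel_itv n0 nn))//.
rewrite lerBlDr (le_trans (majorant_primitive_le _))// lerDl.
exact: majorant_primitive_ge0.
Qed.

(** Nonstationary phase: [g] has absolute value at most [1] and a primitive of
size [1 / lambda], as have sine and cosine at frequency [lambda].  On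
[(0, 1 / lambda)] the oscillation is ignored.  Beyond that, [kernel * g] is
dominated by the derivative of [kernel * (G - 1 / lambda)], because both
[kernel'] and [G - 1 / lambda] are nonpositive. *)
Section Oscillation.
Variables (g G : R -> R) (lambda : R).
Hypotheses (lambda0 : 0 < lambda) (g1 : forall x, `|g x| <= 1)
  (cg : forall x : R, {for x, continuous g})
  (dG : forall x : R, is_derive x (1 : R) G (g x))
  (G1 : forall x, `|G x| <= lambda^-1).

Let kg s := kernel s * g s.

Let ckg (x : R) : 0 < x -> {for x, continuous kg}.
Proof. by move=> x0; apply: continuousM; [exact: continuous_kernel|exact: cg]. Qed.

Lemma integrable_kernel_osc : leb.-integrable Rplus (EFin \o kg).
Proof.
apply: (le_integrable _ _ _ integrable_kernel) => //.
  apply/measurable_EFinP; apply: measurable_funM.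
    by apply: measurable_funTS; exact: measurable_kernel.
  by apply: measurable_funTS; exact: continuous_measurable_fun.
move=> x _; rewrite /= lee_fin normrM ler_piMr//.
Qed.

Let osc_near0 a : 0 < a -> a < lambda^-1 ->
  \int[leb]_(x in `[a, lambda^-1]) kg x <= kappa / (1 - omega) * lambda `^ (omega - 1).
Proof.
move=> a0 al; have l0 : 0 < lambda^-1 by rewrite invr_gt0.
apply: (@le_trans _ _ (\int[leb]_(x in `[a, lambda^-1]) kernel x)).
  apply: le_Rintegral.
  - exact: measurable_itv.
  - exact: continuous_pos_integrable.
  - by apply: continuous_pos_integrable => // x x0; exact: continuous_kernel.
  - move=> x _; rewrite /kg ler_piMr ?kernel_ge0//.
    by have := g1 x; rewrite ler_norml => /andP[].
apply: (le_trans (integral_kernel_itv a0 al)).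
rewrite lerBlDr (le_trans (majorant_primitive_le_near0 l0))//.
rewrite -(powR_inv1 (ltW lambda0)) -powRrM.
have -> : -1 * (1 - omega) = omega - 1 by ring.
by rewrite lerDl majorant_primitive_ge0.
Qed.

Let osc_tail b : lambda^-1 < b ->
  \int[leb]_(x in `[lambda^-1, b]) kg x <= 2 * kappa * lambda `^ (omega - 1).
Proof.
move=> lb; have l0 : 0 < lambda^-1 by rewrite invr_gt0.
have b0 : 0 < b by exact: lt_trans lb.
have GB x : G x - lambda^-1 <= 0 /\ lambda^-1 - G x <= 2 * lambda^-1.
  by have := G1 x; rewrite ler_norml => /andP[]; split; lra.
have dW (x : R) : 0 < x -> is_derive x (1 : R) (fun s => kernel s * (G s - lambda^-1))
    (kernel x * g x + (G x - lambda^-1) * kernel_prime x).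
  move=> x0.
  have H := is_deriveM (is_derive_kernel x0)
    (is_deriveB (dG x) (is_derive_cst lambda^-1 x 1)).
  by apply: (is_derive_eq H); rewrite subr0.
apply: (le_trans (@Rintegral_le_primitive kg _ _ _ _ l0 lb ckg _ dW _)).
- move=> x x0; apply: continuousD; first exact: ckg.
  apply: continuousM; last exact: continuous_kernel_prime.
  apply: continuousB; last exact: cvg_cst.
  by apply: is_derive_continuous; exact: dG.
- move=> x _; rewrite lerDl mulr_le0//; last exact: kernel_prime_le0.
  by have [] := GB x.
have [GBb _] := GB b; have [_ GBl] := GB lambda^-1.
have W1 : kernel b * (G b - lambda^-1) <= 0 by rewrite mulr_ge0_le0 ?kernel_ge0.
have W2 : kernel lambda^-1 * (lambda^-1 - G lambda^-1) <=
    kernel lambda^-1 * (2 * lambda^-1) by rewrite ler_wpM2l ?kernel_ge0.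
have k1 : kernel lambda^-1 <= kappa * lambda `^ omega.
  rewrite /kernel -(powR_inv1 (ltW lambda0)) -powRrM mulrNN mul1r ler_piMr//.
    by rewrite mulr_ge0 ?powR_ge0 ?ltW.
  by rewrite -[leRHS]expR0 ler_expR mulNr oppr_le0 mulr_ge0 ?powR_ge0 ?ltW.
have W3 : kernel lambda^-1 * (2 * lambda^-1) <= kappa * lambda `^ omega * (2 * lambda^-1).
  by rewrite ler_wpM2r// mulr_ge0 ?ltW.
have -> : lambda `^ (omega - 1) = lambda `^ omega * lambda^-1.
  rewrite -(powR_inv1 (ltW lambda0)) -powRD//.
  by apply/implyP => _; rewrite gt_eqF.
lra.
Qed.

(** [exhaustion] needs a nonnegative integrand, whence the function
[h = kernel * (1 + g)]. *)
Lemma oscillatory_upper : \int[leb]_(x in Rplus) (kernel x * g x) <=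
  (kappa / (1 - omega) + 2 * kappa) * lambda `^ (omega - 1).
Proof.
set B := _ * _ `^ _.
have l0 : 0 < lambda^-1 by rewrite invr_gt0.
have ik := integrable_kernel; have ikg := integrable_kernel_osc.
pose h s := kernel s + kg s.
have h0 s : 0 <= h s.
  have -> : h s = kernel s * (1 + g s) by rewrite /h /kg; ring.
  rewrite mulr_ge0 ?kernel_ge0//.
  by have := g1 s; rewrite ler_norml => /andP[]; lra.
have ih : leb.-integrable Rplus (EFin \o h).
  by apply: (integrableD _ ik ikg).
set m0 := \int[leb]_(x in Rplus) kernel x.
suff : (\int[leb]_(x in Rplus) (h x)%:E <= (m0 + B)%:E)%E.
  have -> : (\int[leb]_(x in Rplus) (h x)%:E)%E =
            (\int[leb]_(x in Rplus) h x)%:E.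
    by rewrite /Rintegral fineK//; exact: integrable_fin_num.
  by rewrite lee_fin RintegralD// -/m0 lerD2l.
apply: exhaustion => //; first by have /integrableP[/measurable_EFinP] := ih.
pose N := Num.truncn (Num.max lambda lambda^-1).
exists N => // n /= Nn.
have := truncnS_gt (Num.max lambda lambda^-1); rewrite gt_max => /andP[ln lVn].
have Nn1 : N.+1%:R <= n.+1%:R :> R by rewrite ler_nat ltnS.
have a0 : (0 : R) < n.+1%:R^-1 by rewrite invr_gt0.
have al : n.+1%:R^-1 < lambda^-1.
  by rewrite ltf_pV2 ?posrE//; exact: lt_le_trans ln Nn1.
have lb : lambda^-1 < n.+1%:R by exact: lt_le_trans lVn Nn1.
have ch (x : R) : 0 < x -> {for x, continuous h}.
  by move=> x0; apply: continuousD; [exact: continuous_kernel|exact: ckg].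
rewrite integral_EFin_itv// lee_fin.
have ck (x : R) : 0 < x -> {for x, continuous kernel} by exact: continuous_kernel.
rewrite RintegralD//; try exact: continuous_pos_integrable.
apply: lerD.
  rewrite -lee_fin -integral_EFin_itv//.
  rewrite /m0 /Rintegral fineK; last exact: integrable_fin_num.
  apply: ge0_subset_integral => //.
  - by have /integrableP[] := ik.
  - by move=> x _; rewrite lee_fin kernel_ge0.
  - by move=> x /=; rewrite !in_itv/= andbT => /andP[+ _]; exact: lt_le_trans.
have := @Rintegral_itvB _ kg (BLeft n.+1%:R^-1) (BRight n.+1%:R) lambda^-1
  (continuous_pos_integrable _ a0 ckg).
rewrite !bnd_simp => /(_ (ltW al) (ltW lb))/eqP; rewrite subr_eq => /eqP ->.
rewrite Rintegral_itv_obnd_cbnd; last first.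
  apply: (@integrableS _ _ _ leb `[lambda^-1, n.+1%:R]%classic) => //.
    by move=> x /=; rewrite !in_itv/= => /andP[/ltW -> ->].
  exact: continuous_pos_integrable.
rewrite /B mulrDl [leRHS]addrC.
by apply: lerD; [exact: osc_tail|exact: osc_near0].
Qed.

End Oscillation.

Lemma oscillatory_bound g G lambda : 0 < lambda -> (forall x, `|g x| <= 1) ->
  (forall x : R, {for x, continuous g}) ->
  (forall x : R, is_derive x (1 : R) G (g x)) ->
  (forall x, `|G x| <= lambda^-1) ->
  `|\int[leb]_(x in Rplus) (kernel x * g x)| <=
  (kappa / (1 - omega) + 2 * kappa) * lambda `^ (omega - 1).
Proof.
move=> l0 g1 cg dG G1; rewrite ler_norml oscillatory_upper// andbT.
have ig := integrable_kernel_osc g1 cg.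
have := @oscillatory_upper (fun x => - g x) (fun x => - G x) lambda l0.
have -> : \int[leb]_(x in Rplus) (kernel x * - g x) =
          - \int[leb]_(x in Rplus) (kernel x * g x).
  rewrite -mulN1r -RintegralZl//.
  by apply: eq_Rintegral => x _; rewrite mulrN mulN1r.
move=> H; rewrite lerNl; apply: H => x.
- by rewrite normrN.
- by apply: continuousN; exact: cg.
- by rewrite normrN.
Qed.

End Kernel.

(** * Functions valued in an eigenline *)
Section Line.
Context {R : realType} {X : lmodType R} (ip : X -> X -> R).
Hypothesis ipP : semi_inner_product ip.
Variables (A : operator (X := X)) (gamma : R^nat).
Hypothesis selfadjA : selfadjoint ip A.
Variables (m : nat) (e : X).
Hypothesis eigen_e : Defs.eigenspace ip A (gamma m) e.
Hypothesis gamma_gt0 : 0 < gamma m.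
Implicit Types (r c : R) (k h dh : R -> R) (v : X).
Local Notation Rplus := (`]0%R, +oo[%classic : set R).
Local Notation leb := (@lebesgue_measure R).
Local Notation Apow := (power ip A gamma).
Local Notation Hnorm := (Hnorm ip A gamma).
Local Notation Hspace := (Hspace ip A gamma).
Local Notation wnorm2 := (wnorm2 ip A gamma).
Local Notation wspace := (wspace ip A gamma).
Local Notation line h := (fun s : R => h s *: e).

Lemma power_line r c : dom (Apow r) (c *: e) /\
  nrm ip (Apow r (c *: e) - gamma m `^ r *: (c *: e)) = 0.
Proof. by apply: power_eigen => //; exact: eigenspaceZ. Qed.

Lemma Hspace_line r c : Hspace r (c *: e).
Proof. by have [] := power_line (r / 2) c. Qed.

Lemma Hnorm_line r c : Hnorm r (c *: e) = gamma m `^ (r / 2) * (`|c| * nrm ip e).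
Proof.
have [_ /(null_nrm ipP)] := power_line (r / 2) c; rewrite /Defs.Hnorm => ->.
by rewrite !nrmZ// ger0_norm// powR_ge0.
Qed.

Lemma strongly_measurable_power_line r h : measurable_fun setT h ->
  strongly_measurable ip (fun s => Apow r (h s *: e)).
Proof.
move=> mh; have sm := strongly_measurable_line ipP e mh.
have sm0 : strongly_measurable ip (fun=> (0 : R) *: e).
  by apply: strongly_measurable_line => //; exact: measurable_cst.
apply: (@strongly_measurable_lin _ _ _ ipP _ _ _ (gamma m `^ r) sm sm0) => s _.
by rewrite scale0r addr0; have [] := power_line r (h s).
Qed.

Lemma wspace_line k r h B : weight k -> leb.-integrable Rplus (EFin \o k) ->
  measurable_fun setT h -> (forall s, `|h s| <= B) -> wspace k r (line h).
Proof.
move=> [k0 mk] ik mh hB; split; first by move=> s _; exact: Hspace_line.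
  exact: strongly_measurable_power_line.
pose c := (gamma m `^ (r / 2) * nrm ip e) ^+ 2.
have c0 : 0 <= c by exact: sqr_ge0.
have -> : wnorm2 k r (line h) = (\int[leb]_(s in Rplus) (k s * (c * h s ^+ 2))%:E)%E.
  apply: eq_integral => s _; congr (EFin (_ * _)); rewrite Hnorm_line /c !exprMn.
  by rewrite real_normK ?num_real//; ring.
have B0 : 0 <= B by exact: le_trans (hB 0).
have i1 : leb.-integrable Rplus (fun s => (k s * (c * h s ^+ 2))%:E).
  apply: (le_integrable _ _ _ (integrableZl _ (c * B ^+ 2) ik)) => //.
    apply/measurable_EFinP; apply: measurable_funM => //.
    apply: measurable_funM; first exact: measurable_cst.
    by apply: measurable_funX; exact: measurable_funTS.
  move=> s; rewrite /= in_itv/= andbT => s0; rewrite lee_fin.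
  have ch : 0 <= c * h s ^+ 2 by rewrite mulr_ge0 ?sqr_ge0.
  have cB : 0 <= c * B ^+ 2 by rewrite mulr_ge0 ?sqr_ge0.
  rewrite (ger0_norm (mulr_ge0 (k0 s s0) ch)) (ger0_norm (mulr_ge0 cB (k0 s s0))).
  rewrite mulrC ler_wpM2r ?k0// ler_wpM2l// -[h s ^+ 2]real_normK ?num_real//.
  by rewrite ler_sqr ?nnegrE.
exact: integral_fune_lt_pinfty.
Qed.

(** Each of the two factors [A^(r/2)] in the definition of the integral contributes
[gamma m ^ (r/2)]. *)
Lemma wintegral_line k r h : leb.-integrable Rplus (EFin \o (fun s => k s * h s)) ->
  wintegral ip A gamma k r (line h)
    ((gamma m `^ r * \int[leb]_(s in Rplus) (k s * h s)) *: e).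
Proof.
move=> ik v hv; rewrite (ipZl ipP).
transitivity (\int[leb]_(s in Rplus) (k s * h s * (gamma m `^ r * ip e v))).
  by rewrite RintegralZr//; ring.
apply: eq_Rintegral => s _.
have [_ /(null_ip ipP (Apow (r / 2) v)) ->] := power_line (r / 2) (h s).
rewrite !(ipZl ipP).
rewrite (ip_power ipP selfadjA eigen_e hv).
have -> : gamma m `^ r = gamma m `^ (r / 2) * gamma m `^ (r / 2).
  rewrite -powRD; last by apply/implyP => _; rewrite gt_eqF.
  by congr powR; field.
by ring.
Qed.

Lemma ip_line_locally_integrable h v : continuous h ->
  locally_integrable Rplus (fun s => ip (h s *: e) v).
Proof.
move=> ch; have -> : (fun s => ip (h s *: e) v) = (fun s => h s * ip e v).
  by apply/funext => s; rewrite ipZl.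
have cg : continuous (fun s : R => h s * ip e v).
  by move=> s; apply: continuousM; [exact: ch|exact: cvg_cst].
split.
- by apply: measurable_funTS; exact: continuous_measurable_fun.
- exact: interval_open.
- move=> K _ cK.
  have /integrableP[_] : leb.-integrable K (EFin \o (fun s => h s * ip e v)).
    by apply: continuous_compact_integrable => //; exact: continuous_subspaceT.
  by [].
Qed.

Lemma Rintegral_support (f : R -> R) a b : 0 < a ->
  (forall s, ~ (a <= s <= b) -> f s = 0) ->
  \int[leb]_(s in Rplus) f s = \int[leb]_(s in `[a, b]) f s.
Proof.
move=> a0 f0; rewrite Rintegral_mkcond [RHS]Rintegral_mkcond.
apply: eq_Rintegral => s _; rewrite !patchE.
have [sab|sab] := boolP (a <= s <= b).
  rewrite !mem_set//= in_itv/= ?andbT ?sab//.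
  by apply: lt_le_trans a0 _; case/andP: sab.
by rewrite f0 ?if_same//; apply/negP.
Qed.

Lemma derive1_support (f : R -> R) a b : (forall s, ~ (a <= s <= b) -> f s = 0) ->
  forall s, ~ (a <= s <= b) -> derive1 f s = 0.
Proof.
move=> f0 s sab; rewrite derive1E.
have -> : 'D_1 f s = 'D_1 (cst 0) s.
  apply: near_eq_derive.
  have : \forall x \near s, (~` [set` `[a, b]]) x.
    apply: open_nbhs_nbhs; split; last by rewrite /= in_itv.
    by rewrite openC; exact: interval_closed.
  by apply: filterS => x; rewrite /= in_itv/= => /f0 ->.
exact: derive_cst.
Qed.

(** Integration by parts on an interval slightly larger than the support of the
test function, so that the latter vanishes at both ends. *)
Lemma weak_derivative_line h dh : (forall s : R, is_derive s (1 : R) h (dh s)) ->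
  continuous dh -> weak_derivative ip (line h) (line dh).
Proof.
move=> hd cdh v.
have ch : continuous h by move=> s; exact: is_derive_continuous (hd s).
split; [exact: ip_line_locally_integrable|exact: ip_line_locally_integrable|].
move=> phi [sphi [a [b [a0 phi0]]]].
have dphi (s : R) : is_derive s (1 : R) phi (derive1 phi s).
  by split; [exact: (sphi 0%N s)|rewrite derive1E].
have cphi' : continuous (derive1 phi).
  by move=> s; apply: differentiable_continuous; apply/derivable1_diffP; exact: (sphi 1%N s).
pose d := Num.max b a + 1.
have a2 : 0 < a / 2 by rewrite divr_gt0.
have ad : a / 2 < d.
  rewrite /d (@lt_le_trans _ _ a)// ?ltr_pdivrMr ?ltr_pMr ?ltr1n//.
  by rewrite (@le_trans _ _ (Num.max b a)) ?le_max ?lexx ?orbT// lerDl.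
have supp s : ~ (a / 2 <= s <= d) -> ~ (a <= s <= b).
  move=> ns /andP[as_ sb]; apply: ns; apply/andP; split.
    by rewrite (le_trans _ as_)// ler_pdivrMr// ler_peMr ?ler1n// ltW.
  by rewrite /d (le_trans sb)// (@le_trans _ _ (Num.max b a)) ?le_max ?lexx// lerDl.
have phie s : (s == a / 2) || (s == d) -> phi s = 0.
  move=> se; apply: phi0 => /andP[as_ sb]; case/orP: se => /eqP sE; move: as_ sb; rewrite sE.
    by rewrite leNgt ltr_pdivrMr ?ltr_pMr ?ltr1n ?a0.
  by move=> _; apply/negP; rewrite -ltNge /d ltr_pwDr// le_max lexx.
rewrite (@Rintegral_support _ (a / 2) d)//; last first.
  by move=> s /supp sn; rewrite (derive1_support phi0) ?mul0r.
rewrite (@Rintegral_support _ (a / 2) d)//; last first.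
  by move=> s /supp sn; rewrite phi0 ?mul0r.
pose H s := h s * ip e v; pose H' s := dh s * ip e v.
transitivity (\int[leb]_(x in `[a / 2, d]) (H x * derive1 phi x)).
  by apply: eq_Rintegral => s _; rewrite (ipZl ipP) mulrC.
have dH (s : R) : is_derive s (1 : R) H (H' s).
  have E := is_deriveM (hd s) (is_derive_cst (ip e v) s 1).
  by apply: (is_derive_eq E); rewrite /GRing.scale/= mulr0 add0r mulrC.
have LR (f df : R -> R) : (forall s : R, is_derive s (1 : R) f (df s)) ->
    derivable_oo_LRcontinuous f (a / 2) d.
  move=> fd; split.
  - by move=> x _; have [] := fd x.
  - by apply: cvg_at_right_filter; exact: is_derive_continuous (fd _).
  - by apply: cvg_at_left_filter; exact: is_derive_continuous (fd _).
rewrite (@Rintegration_by_parts _ H phi H' (derive1 phi))//.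
- rewrite (phie d) ?eqxx ?orbT// (phie (a / 2)) ?eqxx// !mulr0 subrr sub0r.
  by congr (- _); apply: eq_Rintegral => s _; rewrite (ipZl ipP) mulrC.
- apply: continuous_subspaceT => s; apply: continuousM; [exact: cdh|exact: cvg_cst].
- exact: LR dH.
- by move=> s _; rewrite derive1E; have [_ ->] := dH s.
- exact: continuous_subspaceT.
- exact: LR dphi.
Qed.

End Line.

(** * States carried by an eigenvector *)
Section Modes.
Context {R : realType} {X : lmodType R} (ip : X -> X -> R).
Hypothesis ipP : semi_inner_product ip.
Variables (A : operator (X := X)) (gamma : R^nat).
Hypothesis selfadjA : selfadjoint ip A.
Variables (m : nat) (e : X).
Hypothesis eigen_e : Defs.eigenspace ip A (gamma m) e.
Hypothesis gamma_gt0 : 0 < gamma m.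
Local Notation Rplus := (`]0%R, +oo[%classic : set R).
Local Notation leb := (@lebesgue_measure R).
Local Notation Apow := (power ip A gamma).
Local Notation line h := (fun s : R => h s *: e).
Variables (alpha sigma : R) (mu beta : R -> R).
Hypotheses (wmu : weight mu) (imu : leb.-integrable Rplus (EFin \o mu)).
Hypothesis beta0 : forall s, 0 < s -> beta s = 0.
Local Notation D := (phase_space ip A gamma alpha mu beta).
Local Notation N := (phase_norm ip A gamma alpha mu beta).

Lemma weight_beta : weight beta.
Proof.
split=> [s s0|]; first by rewrite beta0.
have mc : measurable_fun Rplus (cst (0 : R)) by exact: measurable_cst.
apply: eq_measurable_fun mc => s.
by rewrite inE/= in_itv/= andbT => /beta0.
Qed.

Lemma integrable_beta : leb.-integrable Rplus (EFin \o beta).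
Proof.
have i0 : leb.-integrable Rplus (cst 0%E) by exact: integrable0.
apply: eq_integrable i0 => // s.
by rewrite inE/= in_itv/= andbT => /beta0 ->.
Qed.

Lemma wnorm2_beta r eta : wnorm2 ip A gamma beta r eta = 0%E.
Proof.
apply: integral0_eq => s; rewrite /= in_itv/= andbT => /beta0 ->.
by rewrite mul0r.
Qed.

Definition mode (c1 c2 c3 : R) (h : R -> R) : state :=
  (c1 *: e, c2 *: e, c3 *: e, line h, fun=> 0).

Lemma mode_lin k c1 c2 c3 h d1 d2 d3 g :
  k *: mode c1 c2 c3 h + mode d1 d2 d3 g =
  mode (k * c1 + d1) (k * c2 + d2) (k * c3 + d3) (fun s => k * h s + g s).
Proof.
rewrite /mode state_lin; congr (_, _, _, _, _); rewrite ?scalerA -?scalerDl//.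
  by apply/funext => s; rewrite scalerDl -scalerA.
by rewrite (_ : (fun=> 0) = 0 :> (R -> X))// scaler0 addr0.
Qed.

Definition bounded_C1 (h dh : R -> R) := [/\ h 0 = 0,
  forall s : R, is_derive s (1 : R) h (dh s), continuous dh,
  exists B, forall s, `|h s| <= B & exists B, forall s, `|dh s| <= B].

Lemma mode_phase_space c1 c2 c3 (h : R -> R) : measurable_fun setT h ->
  (exists B, forall s, `|h s| <= B) -> D (mode c1 c2 c3 h).
Proof.
move=> mh [B hB]; split.
- exact: (Hspace_line ipP selfadjA eigen_e).
- exact: (wspace_line ipP selfadjA eigen_e _ wmu imu mh hB).
- exact: (wspace0 ipP gamma selfadjA beta 2).1.
Qed.

Lemma wderivative_line h dh : bounded_C1 h dh ->
  wderivative ip A gamma mu alpha (line h) (line dh).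
Proof.
move=> [h00 hd cdh [B hB] [B' dhB]].
have ch : continuous h by move=> s; exact: is_derive_continuous (hd s).
have wh := wspace_line ipP selfadjA eigen_e alpha wmu imu
  (continuous_measurable_fun ch) hB.
split; [exact: wh| |].
  exact: (wspace_line ipP selfadjA eigen_e _ wmu imu
    (continuous_measurable_fun cdh) dhB).
exists (line h); split; [exact: wh| | |].
- by rewrite subrr; exact: (wspace0 ipP gamma selfadjA mu alpha).2.
- exact: (weak_derivative_line ipP _ hd cdh).
have : gamma m `^ (alpha / 2) * (`|h s| * nrm ip e) @[s --> 0^'+] --> (0 : R).
  rewrite -[X in _ --> X](mulr0 (gamma m `^ (alpha / 2))); apply: cvgMr.
  rewrite -[X in _ --> X](mul0r (nrm ip e)); apply: cvgMl.
  rewrite -[X in _ --> X](normr0 R); apply: cvg_norm.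
  by rewrite -[X in _ --> X]h00; apply: cvg_at_right_filter; exact: ch.
apply: cvg_trans; apply: near_eq_cvg; apply: nearW => s.
by rewrite (Hnorm_line ipP selfadjA eigen_e).
Qed.

Lemma wderivative_beta0 : wderivative ip A gamma beta 2 (fun=> 0) (fun=> 0).
Proof.
have w0 := (wspace0 ipP gamma selfadjA beta 2).1.
split; [exact: w0|exact: w0|].
exists (fun=> 0); split; [exact: w0|exact: wnorm2_beta| |].
- have hd0 (s : R) : is_derive s (1 : R) (cst (0 : R)) (cst (0 : R) s).
    exact: is_derive_cst.
  have c0 : continuous (cst (0 : R) : R -> R) by move=> s; exact: cvg_cst.
  have := weak_derivative_line ipP 0 hd0 c0.
  rewrite (_ : (fun s : R => cst 0 s *: (0 : X)) = (fun=> 0))//.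
  by apply/funext => s; rewrite scaler0.
- rewrite (_ : (fun=> _) = cst 0); first exact: cvg_cst.
  by apply/funext => s; exact: (Hspace0 ipP gamma selfadjA 2).2.
Qed.

Lemma null_add x x' y y' : nrm ip (x - x') = 0 -> nrm ip (y - y') = 0 ->
  nrm ip (x + y - (x' + y')) = 0.
Proof. by move=> xx yy; have := null_lin ipP 1 xx yy; rewrite !scale1r. Qed.

Lemma operator_line c : dom A (c *: e) /\ nrm ip (A (c *: e) - (gamma m * c) *: e) = 0.
Proof.
have [d E] := eigenspaceZ ipP selfadjA c eigen_e.
by split=> //; rewrite -scalerA.
Qed.

Lemma operator_sqr_line c : dom A (A (c *: e)) /\
  nrm ip (A (A (c *: e)) - (gamma m ^+ 2 * c) *: e) = 0.
Proof.
have [d1 E1] := operator_line c; have [d2 E2] := operator_line (gamma m * c).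
have [d3 E3] := operator_null ipP selfadjA (etrans (nrmBC ipP _ _) E1) d2.
split=> //; apply: (null_trans ipP E3).
by rewrite expr2 -mulrA.
Qed.

(** On states carried by an eigenvector the generator acts on the coefficients;
the [xi] component, of weight [0], is invisible to the norm. *)
Lemma system_graph_mode c1 c2 c3 h dh : bounded_C1 h dh ->
  system_graph ip A gamma alpha sigma mu beta (mode c1 c2 c3 h)
    (mode c2
      (gamma m `^ sigma * c3 - gamma m ^+ 2 * c1)
      (- (gamma m `^ alpha * \int[leb]_(s in Rplus) (mu s * h s))
        - gamma m `^ sigma * c2)
      (fun s => c3 - dh s)).
Proof.
move=> hC1; have [h00 hd cdh [B hB] [B' dhB]] := hC1.
have ch : continuous h by move=> s; exact: is_derive_continuous (hd s).
have mh := continuous_measurable_fun ch.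
have mdh := continuous_measurable_fun cdh.
have mcdh : measurable_fun setT (fun s => c3 - dh s).
  by apply: measurable_funB => //; exact: measurable_cst.
have bcdh : exists C, forall s, `|c3 - dh s| <= C.
  exists (`|c3| + B') => s; rewrite (le_trans (ler_normB _ _))//.
  by rewrite lerD2l.
have etaE : (fun s => - (dh s *: e) + c3 *: e) = line (fun s => c3 - dh s).
  by apply/funext => s; rewrite scalerBl addrC.
split.
- by apply: mode_phase_space => //; exists B.
- split; first exact: (operator_line c1).1.
  exact: (operator_sqr_line c1).1.
- by split; exact: (Hspace_line ipP selfadjA eigen_e).
exists ((gamma m `^ alpha * \int[leb]_(s in Rplus) (mu s * h s)) *: e), 0,
  (line dh), (fun=> 0); split.
- apply: (wintegral_line ipP selfadjA eigen_e gamma_gt0).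
  apply: (le_integrable _ _ _ (integrableZl _ B imu)) => //.
  + apply/measurable_EFinP; apply: measurable_funM; first exact: wmu.2.
    exact: measurable_funTS.
  + move=> s _; rewrite /= lee_fin !normrM mulrC ler_wpM2r//.
    by rewrite (le_trans (hB s))// ler_norm.
- move=> v _; rewrite (ip0l ipP); apply/esym; rewrite /Rintegral integral0_eq//.
  by move=> s; rewrite /= in_itv/= andbT => /beta0 ->; rewrite mul0r.
- exact: wderivative_line.
- exact: wderivative_beta0.
rewrite etaE; split.
- split; first exact: (Hspace_line ipP selfadjA eigen_e).
    have [C hC] := bcdh.
    exact: (wspace_line ipP selfadjA eigen_e _ wmu imu mcdh hC).
  rewrite (_ : (fun=> _) = line (cst c2)); last first.
    by apply/funext => s; rewrite oppr0 add0r.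
  apply: (wspace_line (B := `|c2|) ipP selfadjA eigen_e _ weight_beta integrable_beta).
    exact: measurable_cst.
  by [].
- exact: mode_phase_space.
rewrite /mode (_ : _ - _ = (c2 *: e - c2 *: e,
  (gamma m `^ sigma * c3 - gamma m ^+ 2 * c1) *: e -
    (- 0 - A (A (c1 *: e)) + Apow sigma (c3 *: e)),
  (- (gamma m `^ alpha * \int[leb]_(s in Rplus) (mu s * h s))
        - gamma m `^ sigma * c2) *: e -
    (- ((gamma m `^ alpha * \int[leb]_(s in Rplus) (mu s * h s)) *: e)
     - Apow sigma (c2 *: e)),
  line (fun s => c3 - dh s) - line (fun s => c3 - dh s),
  (fun=> 0) - (fun=> - 0 + c2 *: e)))//.
have [_ p3] := power_line ipP selfadjA eigen_e sigma c3.
have [_ p2] := power_line ipP selfadjA eigen_e sigma c2.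
have [_ A2] := operator_sqr_line c1.
rewrite /phase_norm wnorm2_beta !subrr (Hspace0 ipP gamma selfadjA 2).2.
rewrite (wspace0 ipP gamma selfadjA mu alpha).2.
set n1 := nrm _ _; set n2 := nrm _ _.
have -> : n1 = 0.
  rewrite /n1 (nrmBC ipP) oppr0 add0r scalerBl [(_ *: e) - _]addrC.
  apply: null_add; last by rewrite -scalerA.
  by have := null_scale ipP (-1) A2; rewrite !scaleN1r.
have -> : n2 = 0.
  rewrite /n2 (nrmBC ipP) scalerBl scaleNr.
  apply: null_add; first by rewrite subrr nrm0.
  by have := null_scale ipP (-1) p2; rewrite !scaleN1r scalerA.
by rewrite expr0n/= !addr0 sqrtr0.
Qed.

Variable S : R -> state (X := X) -> state (X := X).
Hypothesis SP : solution_semigroup ip A gamma alpha sigma mu beta S.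

Lemma generator_mode c1 c2 c3 h dh : bounded_C1 h dh ->
  generator D N S (mode c1 c2 c3 h)
    (mode c2
      (gamma m `^ sigma * c3 - gamma m ^+ 2 * c1)
      (- (gamma m `^ alpha * \int[leb]_(s in Rplus) (mu s * h s))
        - gamma m `^ sigma * c2)
      (fun s => c3 - dh s)).
Proof.
move=> hC1; have [h00 hd cdh [B hB] [B' dhB]] := hC1.
have ch : continuous h by move=> s; exact: is_derive_continuous (hd s).
have [_ gen] := SP; apply/gen; split.
- by apply: mode_phase_space; [exact: continuous_measurable_fun|exists B].
- apply: mode_phase_space.
    apply: measurable_funB; first exact: measurable_cst.
    exact: continuous_measurable_fun.
  exists (`|c3| + B') => s; rewrite (le_trans (ler_normB _ _))//.
  by rewrite lerD2l.
move=> eps eps0; eexists; eexists; split; first exact: (system_graph_mode c1 c2 c3 hC1).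
  by rewrite subrr (phase_norm0 ipP gamma selfadjA).
by rewrite subrr (phase_norm0 ipP gamma selfadjA).
Qed.

Lemma phase_norm_theta r : N (mode 0 0 r (cst 0)) = `|r| * nrm ip e.
Proof.
rewrite /phase_norm/= wnorm2_beta (_ : line (cst 0) = 0); last first.
  by apply/funext => s; rewrite scale0r.
rewrite !scale0r (Hspace0 ipP gamma selfadjA 2).2 (nrm0 ipP).
rewrite (wspace0 ipP gamma selfadjA mu alpha).2 expr0n/= !add0r !addr0.
by rewrite (nrmZ ipP) sqrtr_sqr ger0_norm// mulr_ge0 ?nrm_ge0.
Qed.

Lemma phase_norm_ge_theta c1 c2 c3 h :
  `|c3| * nrm ip e <= N (mode c1 c2 c3 h).
Proof.
rewrite -(nrmZ ipP) -ler_sqr ?nnegrE ?nrm_ge0 ?phase_norm_ge0//.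
rewrite (sqr_phase_norm ip A gamma alpha wmu weight_beta) wnorm2_beta addr0.
have h1 := sqr_ge0 (Defs.Hnorm ip A gamma 2 (c1 *: e)).
have h2 := sqr_ge0 (nrm ip (c2 *: e)).
have h3 := fine_wnorm2_ge0 ip A gamma alpha (line h) wmu.
have le4 (x y z w : R) : 0 <= y -> 0 <= z -> 0 <= w -> x <= y + z + x + w by lra.
exact: le4.
Qed.

Lemma phase_seminorm : seminorm_on D N.
Proof.
split.
- exact: phase_space0.
- exact: phase_norm0.
- exact: phase_norm_ge0.
- by move=> a z w; exact: (phase_space_lin ipP selfadjA wmu weight_beta).
- by move=> a z w; exact: (phase_norm_lin ipP selfadjA wmu weight_beta).
Qed.

End Modes.

(** * Resonant quasimodes *)
Section Trigonometric.
Context {R : realType}.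
Variable lambda : R.
Hypothesis lambda0 : 0 < lambda.

Lemma continuous_scaled (g : R -> R) : continuous g -> continuous (fun s => g (lambda * s)).
Proof.
by move=> cg s; apply: continuous_comp; [exact: mulrl_continuous|exact: cg].
Qed.

Lemma is_derive_sin_scaled (s : R) :
  is_derive s (1 : R) (fun s => sin (lambda * s) / lambda) (cos (lambda * s)).
Proof.
have H := is_deriveM (is_derive_scaled (is_derive_sin (lambda * s)))
  (is_derive_cst lambda^-1 s 1).
apply: (is_derive_eq H); rewrite /GRing.scale/= mulr0 add0r.
by rewrite mulrA mulVf ?mul1r// gt_eqF.
Qed.

Lemma is_derive_cos_scaled (s : R) :
  is_derive s (1 : R) (fun s => cos (lambda * s) / lambda) (- sin (lambda * s)).
Proof.
have H := is_deriveM (is_derive_scaled (dg := fun x => - sin x) (is_derive_cos (lambda * s)))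
  (is_derive_cst lambda^-1 s 1).
apply: (is_derive_eq H); rewrite /GRing.scale/= mulr0 add0r.
by rewrite mulrA mulVf ?mul1r// gt_eqF.
Qed.

Lemma bounded_C1_sin :
  bounded_C1 (fun s => sin (lambda * s) / lambda) (fun s => cos (lambda * s)).
Proof.
split.
- by rewrite mulr0 sin0 mul0r.
- exact: is_derive_sin_scaled.
- by apply: continuous_scaled; exact: continuous_cos.
- exists lambda^-1 => s; rewrite normrM (gtr0_norm (_ : 0 < lambda^-1)) ?invr_gt0//.
  by rewrite ler_piMl ?sin_norm_le1// invr_ge0 ltW.
- by exists 1 => s; exact: cos_norm_le1.
Qed.

Lemma bounded_C1_cos :
  bounded_C1 (fun s => (cos (lambda * s) - 1) / lambda) (fun s => - sin (lambda * s)).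
Proof.
split.
- by rewrite mulr0 cos0 subrr mul0r.
- move=> s; have H := is_deriveB (is_derive_cos_scaled s) (is_derive_cst lambda^-1 s 1).
  rewrite subr0 in H.
  rewrite (_ : (fun s => _) = (fun s => cos (lambda * s) / lambda) - cst lambda^-1)//.
  by apply/funext => x; rewrite mulrBl mul1r.
- by move=> s; apply: continuousN; apply: continuous_scaled; exact: continuous_sin.
- exists (2 * lambda^-1) => s.
  rewrite normrM (gtr0_norm (_ : 0 < lambda^-1)) ?invr_gt0//.
  rewrite ler_wpM2r ?invr_ge0 ?(ltW lambda0)// (le_trans (ler_normB _ _))//.
  by have := cos_norm_le1 (lambda * s); rewrite normr1; lra.
- by exists 1 => s; rewrite normrN; exact: sin_norm_le1.
Qed.

End Trigonometric.

(** The larger root of [(x - g) (x - k) = x q]: at [x = g] the left-hand side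
vanishes and the right-hand side is positive. *)
Lemma resonant_frequency (R : realType) (g k q : R) : 0 < g -> 0 <= k -> 0 < q ->
  exists2 x, g < x & (x - g) * (x - k) = x * q.
Proof.
move=> g0 k0 q0; pose B := g + k + q; pose d := B ^+ 2 - 4 * g * k.
have dE : d = (g - k - q) ^+ 2 + 4 * g * q by rewrite /d /B; ring.
have gq : 0 < 4 * g * q by rewrite !mulr_gt0.
have d0 : 0 <= d by rewrite dE addr_ge0 ?sqr_ge0// ltW.
have s2 : Num.sqrt d ^+ 2 = d by rewrite sqr_sqrtr.
exists ((B + Num.sqrt d) / 2).
  have : g - k - q < Num.sqrt d.
    rewrite (le_lt_trans (ler_norm _))// -sqrtr_sqr ltr_sqrt ?dE ?ltrDl//.
    by rewrite ltr_wpDl ?sqr_ge0.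
  by rewrite /B; lra.
apply/eqP; rewrite -subr_eq0; apply/eqP.
transitivity ((Num.sqrt d ^+ 2 - d) / 4); last by rewrite s2 subrr mul0r.
by move: (Num.sqrt d) => s; rewrite /d /B; field.
Qed.

Section QuasiModes.
Context {R : realType} {X : lmodType R} (ip : X -> X -> R).
Hypothesis ipP : semi_inner_product ip.
Variables (A : operator (X := X)) (gamma : R^nat).
Hypothesis selfadjA : selfadjoint ip A.
Local Notation Rplus := (`]0%R, +oo[%classic : set R).
Local Notation leb := (@lebesgue_measure R).
Variables (alpha sigma kappa omega delta : R) (mu beta : R -> R).
Hypotheses (kappa0 : 0 < kappa) (omega0 : 0 <= omega) (omega1 : omega < 1)
  (delta0 : 0 < delta).
Hypothesis muE : forall s, 0 < s -> mu s = kernel kappa omega delta s.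
Hypothesis beta0 : forall s, 0 < s -> beta s = 0.
Local Notation D := (phase_space ip A gamma alpha mu beta).
Local Notation N := (phase_norm ip A gamma alpha mu beta).
Variable S : R -> state (X := X) -> state (X := X).
Hypothesis SP : solution_semigroup ip A gamma alpha sigma mu beta S.

Lemma mu_kernel : {in Rplus, mu =1 kernel kappa omega delta}.
Proof. by move=> s; rewrite inE/= in_itv/= andbT => /muE. Qed.

Lemma weight_mu : weight mu.
Proof.
split=> [s s0|]; first by rewrite muE// kernel_ge0.
have mk : measurable_fun Rplus (kernel kappa omega delta).
  by apply: measurable_funTS; exact: measurable_kernel.
by apply: eq_measurable_fun mk => s sR; rewrite mu_kernel.
Qed.

Lemma integrable_mu : leb.-integrable Rplus (EFin \o mu).
Proof.
have ik := integrable_kernel kappa0 omega0 omega1 delta0.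
by apply: eq_integrable ik => // s sR; rewrite /= mu_kernel.
Qed.

Lemma integrable_mu_bounded (g : R -> R) : continuous g -> (forall s, `|g s| <= 1) ->
  leb.-integrable Rplus (EFin \o (fun s => mu s * g s)).
Proof.
move=> cg g1; apply: (le_integrable _ _ _ integrable_mu) => //.
  apply/measurable_EFinP; apply: measurable_funM; first exact: weight_mu.2.
  by apply: measurable_funTS; exact: continuous_measurable_fun.
by move=> x _; rewrite /= lee_fin normrM ler_piMr.
Qed.

Definition osc_constant := kappa / (1 - omega) + 2 * kappa.

Lemma oscillatory_mu (g G : R -> R) lambda : 0 < lambda -> (forall x, `|g x| <= 1) ->
  continuous g -> (forall x : R, is_derive x (1 : R) G (g x)) ->
  (forall x, `|G x| <= lambda^-1) ->
  `|\int[leb]_(x in Rplus) (mu x * g x)| <= osc_constant * lambda `^ (omega - 1).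
Proof.
move=> l0 g1 cg dG G1.
have -> : \int[leb]_(x in Rplus) (mu x * g x) =
          \int[leb]_(x in Rplus) (kernel kappa omega delta x * g x).
  by apply: eq_Rintegral => s sR; rewrite mu_kernel.
exact: (oscillatory_bound kappa0 omega0 omega1 delta0 l0 g1 cg dG G1).
Qed.

Variables (m : nat) (e : X).
Hypothesis eigen_e : Defs.eigenspace ip A (gamma m) e.
Hypothesis e1 : nrm ip e = 1.
Hypothesis gamma_gt0 : 0 < gamma m.

Lemma mode_eq c1 c2 c3 (h : R -> R) d1 d2 d3 g : c1 = d1 -> c2 = d2 -> c3 = d3 ->
  h =1 g -> mode e c1 c2 c3 h = mode e d1 d2 d3 g.
Proof. by move=> -> -> -> /funext ->. Qed.

(** [a] and [b] are the real and imaginary parts of the solution, normalized by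
[theta = 1], of the equations at the frequency [lambda], with the Fourier
integral of [mu] dropped from the equation of [theta]: the [u] equation fixes
[u] and the [eta] equation gives
[eta = (1 - e^(- i lambda s)) / (i lambda)].  The dropped integral is what remains
in [r1] (sine part) and [r2] (cosine part). *)
Lemma quasimode_estimate T : 0 < T -> exists a b,
  [/\ D a, D b, 1 <= N a &
      N a + N b <= 2 * (N (S T a) + N (S T b)) +
        2 * T * (2 * osc_constant * (gamma m `^ alpha * gamma m `^ (omega - 2)))].
Proof.
move=> T0.
have pg r : 0 < gamma m `^ r by rewrite powR_gt0.
set m0 := \int[leb]_(s in Rplus) mu s.
have m00 : 0 <= m0.
  by apply: Rintegral_ge0 => s; rewrite /= in_itv/= andbT; exact: weight_mu.1.
pose q := gamma m `^ sigma ^+ 2.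
have [x gx xE] : exists2 x, gamma m ^+ 2 < x &
    (x - gamma m ^+ 2) * (x - gamma m `^ alpha * m0) = x * q.
  apply: resonant_frequency; rewrite ?exprn_gt0//.
  by rewrite mulr_ge0 ?(ltW (pg _)).
have x0 : 0 < x by rewrite (lt_trans _ gx)// exprn_gt0.
pose lambda := Num.sqrt x.
have l0 : 0 < lambda by rewrite sqrtr_gt0.
have l2 : lambda ^+ 2 = x by rewrite sqr_sqrtr// ltW.
have gl : gamma m <= lambda.
  by rewrite -ler_sqr ?nnegrE ?l2 ?(ltW l0) ?(ltW gamma_gt0)// ltW.
pose u := - (gamma m `^ sigma / (x - gamma m ^+ 2)).
pose a : state := mode e u 0 1 (fun s => sin (lambda * s) / lambda).
pose b : state := mode e 0 (lambda * u) 0 (fun s => (cos (lambda * s) - 1) / lambda).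
pose Is := \int[leb]_(s in Rplus) (mu s * sin (lambda * s)).
pose Ic := \int[leb]_(s in Rplus) (mu s * cos (lambda * s)).
pose r1 : state := mode e 0 0 (- (gamma m `^ alpha * (Is / lambda))) (cst 0).
pose r2 : state := mode e 0 0 (- (gamma m `^ alpha * (Ic / lambda))) (cst 0).
have csin := continuous_scaled (lambda := lambda) (@continuous_sin R).
have ccos := continuous_scaled (lambda := lambda) (@continuous_cos R).
have isin := integrable_mu_bounded csin (fun s => sin_norm_le1 (lambda * s)).
have icos := integrable_mu_bounded ccos (fun s => cos_norm_le1 (lambda * s)).
have dxg : x - gamma m ^+ 2 != 0 by rewrite subr_eq0 gt_eqF.
have ln0 : lambda != 0 by rewrite gt_eqF.
have ga : generator D N S a (r1 - lambda *: b).
  have := generator_mode ipP selfadjA eigen_e gamma_gt0 weight_mu integrable_mu beta0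
    SP u 0 1 (bounded_C1_sin l0).
  congr generator.
  rewrite /b /r1 [RHS]addrC -(scaleNr lambda). 
  rewrite mode_lin; apply: mode_eq.
  - by rewrite mulr0 addr0.
  - by rewrite mulr1 addr0 mulrA mulNr -expr2 l2 /u; field.
  - rewrite mulr0 subr0 mulr0 add0r; congr (- (_ * _)).
    rewrite /Is -RintegralZr//.
    by apply: eq_Rintegral => s _; rewrite mulrA.
  - by move=> s /=; field.
have gb : generator D N S b (lambda *: a + r2).
  have := generator_mode ipP selfadjA eigen_e gamma_gt0 weight_mu integrable_mu beta0
    SP 0 (lambda * u) 0 (bounded_C1_cos l0).
  congr generator.
  rewrite /a /r2 mode_lin; apply: mode_eq.
  - by rewrite addr0.
  - by rewrite !mulr0 subrr addr0.
  (* This is the [theta] equation; it holds because [x] is resonant. *)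
  - have -> : \int[leb]_(s in Rplus) (mu s * ((cos (lambda * s) - 1) / lambda)) =
        (Ic - m0) / lambda.
      rewrite /Ic /m0 -RintegralB//; last exact: integrable_mu.
      rewrite -RintegralZr//; last first.
        exact: (integrableB _ icos integrable_mu).
      by apply: eq_Rintegral => s _; ring.
    apply/eqP; rewrite -subr_eq0; apply/eqP.
    transitivity ((lambda ^+ 2 * q - (x - gamma m ^+ 2) *
        (lambda ^+ 2 - gamma m `^ alpha * m0)) / (lambda * (x - gamma m ^+ 2))).
      by rewrite /u /q; field; rewrite dxg ln0.
    by rewrite l2 xE subrr mul0r.
  - by move=> s /=; field.
have Dr r : D (mode e 0 0 r (cst 0)).
  apply: (mode_phase_space ipP selfadjA eigen_e alpha beta weight_mu integrable_mu).
    exact: measurable_cst.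
  by exists 0 => s; rewrite normr0.
exists a, b; split.
- by have [] := ga.
- by have [] := gb.
- have := phase_norm_ge_theta ipP A gamma e alpha weight_mu beta0 u 0 1
    (fun s => sin (lambda * s) / lambda).
  by rewrite normr1 mul1r e1.
have sem := phase_seminorm ipP gamma selfadjA alpha weight_mu beta0.
apply: (le_trans (quasimode_lower_bound sem SP.1 T0 ga gb (Dr _) (Dr _))).
rewrite lerD2l ler_wpM2l ?mulr_ge0 ?(ltW T0)//.
rewrite !(phase_norm_theta ipP gamma selfadjA e alpha mu beta0) e1 !mulr1.
have bound I : `|I| <= osc_constant * lambda `^ (omega - 1) ->
    `|- (gamma m `^ alpha * (I / lambda))| <=
    osc_constant * (gamma m `^ alpha * gamma m `^ (omega - 2)).
  move=> hI; rewrite normrN !normrM (gtr0_norm (pg _)).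
  rewrite (gtr0_norm (_ : 0 < lambda^-1)) ?invr_gt0//.
  have lE : lambda `^ (omega - 2) = lambda `^ (omega - 1) * lambda^-1.
    rewrite -(powR_inv1 (ltW l0)) -powRD; last by apply/implyP => _.
    by congr powR; ring.
  apply: (@le_trans _ _ (osc_constant * (gamma m `^ alpha * lambda `^ (omega - 2)))).
    rewrite lE [leRHS]mulrCA (mulrA osc_constant).
    by rewrite ler_wpM2l ?(ltW (pg _))// ler_wpM2r ?invr_ge0 ?(ltW l0).
  have osc0 : 0 <= osc_constant.
    by rewrite addr_ge0 ?divr_ge0 ?mulr_ge0 ?subr_ge0 ?ltW.
  rewrite ler_wpM2l// ler_wpM2l ?(ltW (pg _))//.
  have -> : omega - 2 = - (2 - omega) by ring.
  rewrite !powRN lef_pV2 ?posrE ?powR_gt0//.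
  apply: ge0_ler_powR => //; rewrite ?nnegrE ?(ltW l0) ?(ltW gamma_gt0)//.
  by rewrite subr_ge0 (le_trans (ltW omega1))// ler1n.
have bs := bound _ (oscillatory_mu l0 (fun s => sin_norm_le1 (lambda * s)) csin
  (G := fun s => - (cos (lambda * s) / lambda)) _ _).
have bc := bound _ (oscillatory_mu l0 (fun s => cos_norm_le1 (lambda * s)) ccos
  (G := fun s => sin (lambda * s) / lambda) _ _).
have li : `|lambda^-1| = lambda^-1 by rewrite gtr0_norm// invr_gt0.
rewrite [leRHS](_ : _ = osc_constant * (gamma m `^ alpha * gamma m `^ (omega - 2)) +
  osc_constant * (gamma m `^ alpha * gamma m `^ (omega - 2))); last by ring.
apply: lerD; [apply: bs|apply: bc] => s.
- have H := is_deriveN (is_derive_cos_scaled l0 s).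
  by apply: (is_derive_eq H); rewrite opprK.
- rewrite normrN normrM li ler_piMl ?cos_norm_le1// invr_ge0 ltW//.
- exact: is_derive_sin_scaled.
- rewrite normrM li ler_piMl ?sin_norm_le1// invr_ge0 ltW//.
Qed.

End QuasiModes.

Lemma L2ip_semi_inner_product (R : realType) (Omega : smooth_bounded_domain R) :
  semi_inner_product (@L2ip R Omega).
Proof.
have int (f g : L2 Omega) : (lebesgue_domain Omega).-integrable setT
    (EFin \o (fun x => (f : LfunType (lebesgue_domain Omega) (lee1n 2)) x *
                       (g : LfunType (lebesgue_domain Omega) (lee1n 2)) x)).
  by have := Lfun2_mul_Lfun1 (LfunP f) (LfunP g) => /Lfun1_integrable.
split.
- by move=> f g; apply: eq_Rintegral => x _; rewrite mulrC.
- move=> a f g h; rewrite /L2ip -RintegralZl// -RintegralD//.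
  + by apply: eq_Rintegral => x _ /=; rewrite mulrDl mulrA.
  + by have := integrableZl measurableT a (int f h).
- by move=> f; apply: Rintegral_ge0 => x _; rewrite -expr2 sqr_ge0.
Qed.

Theorem theoremA2 (R : realType) (Omega : smooth_bounded_domain R)
    (A : operator (X := L2 Omega)) (gamma : R^nat)
    (alpha sigma kappa1 omega1 delta1 : R) (mu beta : R -> R)
    (S : R -> state (X := L2 Omega) -> state (X := L2 Omega)) :
  selfadjoint (@L2ip R Omega) A ->
  strictly_positive (@L2ip R Omega) A ->
  discrete_spectrum (@L2ip R Omega) A gamma ->
  0 <= alpha < 2 ->
  0 <= sigma ->
  0 <= omega1 < (2 - alpha) / 2 ->
  0 < kappa1 ->
  0 < delta1 ->
  (forall s, 0 < s -> mu s = kappa1 * s `^ (- omega1) * expR (- delta1 * s)) ->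
  (forall s, 0 < s -> beta s = 0) ->
  solution_semigroup (@L2ip R Omega) A gamma alpha sigma mu beta S ->
  ~ exponentially_stable
      (phase_space (@L2ip R Omega) A gamma alpha mu beta)
      (phase_norm (@L2ip R Omega) A gamma alpha mu beta) S.

Proof.
move=> selfadjA _ [_ eigA gamma_gt0 gammay] /andP[alpha0 alpha2] _
  /andP[omega0 omega_lt] kappa0 delta0 muE beta0 SP [M [w [M1 w0 stable]]].
have ipP := L2ip_semi_inner_product Omega.
have omega_lt1 : omega1 < 1 by lra.
(* The residuals decay like [gamma n ^ (- p)]. *)
pose p := 2 - alpha - omega1.
have p0 : 0 < p by rewrite /p; lra.
(* A time after which the assumed decay has reached the factor [1 / 4]. *)
pose T := 4 * M / w.
have M0 : 0 < M by exact: lt_le_trans M1.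
have T0 : 0 < T by rewrite divr_gt0// mulr_gt0.
have decay : M * expR (- w * T) <= 1 / 4.
  rewrite mulNr expRN mulrC ler_pdivrMl ?expR_gt0//.
  have -> : w * T = 4 * M by rewrite /T; field; rewrite gt_eqF.
  by have := expR_ge1Dx (4 * M); lra.
pose C := osc_constant kappa1 omega1.
(* Once [gamma n ^ p] reaches [K], the residuals cost less than half of
   [N a >= 1] during the time [T]. *)
pose K := 8 * T * C + 1.
have C0 : 0 <= C.
  by rewrite addr_ge0 ?divr_ge0 ?mulr_ge0 ?subr_ge0 ?ltW.
have TC0 : 0 <= 8 * T * C.
  by apply: mulr_ge0 => //; apply: mulr_ge0 => //; exact: ltW.
have K0 : 0 < K by rewrite /K; lra.
have [n Kn] : exists n, K `^ p^-1 <= gamma n.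
  have /cvgryPge/(_ (K `^ p^-1))[n _ Hn] := gammay.
  by exists n; exact: (Hn n (leqnn n)).
have gn0 := gamma_gt0 n.
have Kp : K <= gamma n `^ p.
  rewrite -[leLHS](powRr1 (ltW K0)) -(mulVf (lt0r_neq0 p0)) powRrM.
  by apply: ge0_ler_powR; rewrite ?nnegrE ?(ltW p0) ?powR_ge0 ?(ltW gn0).
have [e0 eigen_e0 e00] := eigA n.
pose e := (nrm (@L2ip R Omega) e0)^-1 *: e0.
have eigen_e : Defs.eigenspace (@L2ip R Omega) A (gamma n) e by exact: eigenspaceZ.
have e1 : nrm (@L2ip R Omega) e = 1.
  by rewrite (nrmZ ipP) ger0_norm ?invr_ge0 ?nrm_ge0// mulVf.
have [a [b [Da Db Na1 ab]]] := quasimode_estimate ipP selfadjA kappa0 omega0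
  omega_lt1 delta0 muE beta0 SP eigen_e e1 gn0 T0.
have sa := stable T a (ltW T0) Da; have sb := stable T b (ltW T0) Db.
set N := phase_norm _ _ _ _ _ _ in Na1 ab sa sb.
have Nb0 : 0 <= N b by exact: phase_norm_ge0.
have gE : gamma n `^ alpha * gamma n `^ (omega1 - 2) = (gamma n `^ p)^-1.
  rewrite -powRD; last by apply/implyP => _; rewrite gt_eqF.
  by rewrite -powRN; congr powR; rewrite /p; ring.
rewrite gE -/C in ab.
have small : 8 * T * C * (gamma n `^ p)^-1 < 1.
  rewrite ltr_pdivrMr ?powR_gt0// mul1r; apply: lt_le_trans Kp.
  by rewrite /K ltrDl.
have da : N (S T a) <= 1 / 4 * N a.
  by apply: (le_trans sa); rewrite ler_wpM2r// (le_trans ler01).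
have db : N (S T b) <= 1 / 4 * N b by apply: (le_trans sb); rewrite ler_wpM2r.
move: ab da db small Na1 Nb0.
move: (N a) (N b) (N (S T a)) (N (S T b)) (gamma n `^ p)^-1 => x y x' y' z.
rewrite (_ : 2 * T * (2 * C * z) = 8 * T * C * z / 2); last by field.
move: (8 * T * C * z) => t; lra.
Qed.
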